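(* Let $n\ge2$ and let $K\in\mathcal{K}^\infty_+$ be a convex body in $E\cong\mathbb{R}^n$. Then the centro-affine Laplacian of $K$ coincides with the Hilbert--Brunn--Minkowski operator of $K$. That is, for every $f\in C^2(\mathbb{S}^* )$, \[ \mathrm{div}^{\nabla_K}\big(\mathrm{grad}_{g_K} f\big) = ((D^2 h_K)^{-1})^{ij} D^2_{ij}( f h_K) - (n-1) f \quad\text{on } \mathbb{S}^*, \] where $g_K=g_K^{\mathbb{S}^*}$ and $\nabla_K=\nabla_K^{\mathbb{S}^*}$ are the centro-affine metric and centro-affine connection of $K$ on $\mathbb{S}^*$; and the same identity of operators holds on every other parametrization $M\in\{\partial K,\mathbb{S},\partial K^*\}$, where the Hilbert--Brunn--Minkowski operator is transported from $\mathbb{S}^*$ to $M$ by the diffeomorphism $T_K^{\mathbb{S}^*\to M}$.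
   Context: $E$ is an $n$-dimensional Euclidean space with scalar product $\langle\cdot,\cdot\rangle$; $E^*$ is its dual, identified with $E$ via the scalar product, and $\langle\cdot,\cdot\rangle$ also denotes the duality pairing. $\mathbb{S}\subset E$, $\mathbb{S}^*\subset E^*$ are the unit spheres. $\bar D$ is the standard flat derivative (gradient/connection). $\mathcal{K}^\infty_+$ is the set of convex bodies in $E$ containing the origin in the interior, with $C^\infty$-smooth boundary of strictly positive curvature. $h_K(x^* )=\max_{x\in K}\langle x^*,x\rangle$ is the support function on $E^*$, $\|x\|_K$ the Minkowski gauge of $K$, $K^*=\{h_K\le1\}\subset E^*$ the dual body. Parametrizations: for $M\in\{\mathbb{S}^*,\partial K,\mathbb{S},\partial K^*\}$ let $x=x_K^M:M\to\partial K$ be the diffeomorphism: $\theta^*\mapsto \bar Dh_K(\theta^* )$ on $\mathbb{S}^*$; the identity on $\partial K$; $\theta\mapsto\theta/\|\theta\|_K$ on $\mathbb{S}$; $x^*\mapsto\bar Dh_K(x^* )$ on $\partial K^*$. Put $T_K^{M_1\to M_2}=(x_K^{M_2})^{-1}\circ x_K^{M_1}$. The conormal $x^*=x_K^*:M\to\partial K^*\subset E^*$ is the map with $\langle x^*,x\rangle=1$ and $\langle x^*,dx\rangle=0$ (i.e. $x^*=\bar D\|\cdot\|_K$ at $x$). Centro-affine structures on $M$: the Riemannian metric $g_K(u,v)=\langle dx^*(u),dx(v)\rangle$, and the torsion-free connection $\nabla_K$ defined by $\bar D_U\,dx(V)=dx((\nabla_K)_UV)-g_K(U,V)x$. $\mathrm{grad}_{g_K}f$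 is the metric gradient, $\mathrm{div}^{\nabla}X=\nabla_iX^i$, and the centro-affine Laplacian is $\Delta_Kf=\mathrm{div}^{\nabla_K}\mathrm{grad}_{g_K}f$. For a $C^2$ function $h$ on $\mathbb{S}^*$, $D^2h$ denotes the restriction to $T\mathbb{S}^*$ of the Euclidean Hessian of the $1$-homogeneous extension of $h$ to $E^*$, i.e. $D^2_{ij}h={}^{\mathbb{S}^*}\nabla^2_{ij}h+h\,\delta^{\mathbb{S}^*}_{ij}$ with ${}^{\mathbb{S}^*}\nabla$ the Levi-Civita connection of the standard metric $\delta^{\mathbb{S}^*}$. The Hilbert--Brunn--Minkowski operator on $\mathbb{S}^*$ is $z\mapsto ((D^2 h_K)^{-1})^{ij} D^2_{ij}( z h_K) - (n-1) z$. *)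

(* Defs.v *)
From HB Require Import structures.
From mathcomp Require Import all_boot all_order all_algebra.
From mathcomp Require Import all_classical all_reals all_analysis.
Set Implicit Arguments.
Unset Strict Implicit.
Unset Printing Implicit Defensive.
Import Order.TTheory GRing.Theory Num.Theory.
Import numFieldNormedType.Exports.
Local Open Scope classical_set_scope.
Local Open Scope ring_scope.

(* E is 'rV[R]_n with the standard scalar product, and E^* is
   identified with E through it.  The norm `|_| of 'rV[R]_n is the sup norm: it
   is used only for the topology and for differentiation, while the Euclidean
   norm is enorm.

   Functions, maps and vector fields on a hypersurface M are represented by
   total functions on E, of which only the values on M matter.  "The object
   such that ..." is rendered by xget, whose default value 0 is returned only
   if no such object exists. *)

Section Euclidean.
Context {R : realType} {n : nat}.
Local Notation E := 'rV[R]_n.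

Definition dot (u v : E) : R := \sum_i u 0 i * v 0 i.

Definition enorm (u : E) : R := Num.sqrt (dot u u).

Definition usphere : set E := [set u | enorm u = 1].

Definition egrad (F : E -> R) (p : E) : E :=
  \row_i 'D_(delta_mx 0 i) F p.

Definition bdry (A : set E) : set E := closure A `\` interior A.

(* F is of class C^k on U, which is meant to be open. *)
Fixpoint Ck (W : normedModType R) (k : nat) (U : set E) (F : E -> W) : Prop :=
  if k is k'.+1
  then (forall p, U p -> differentiable F p) /\
       (forall v, Ck k' U (fun p => 'D_v F p))
  else forall p, U p -> {for p, continuous F}.

Definition Cinfty (W : normedModType R) (U : set E) (F : E -> W) : Prop :=
  forall k, Ck k U F.

End Euclidean.

Section Hypersurface.
Context {R : realType} {n : nat}.
Local Notation E := 'rV[R]_n.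
Implicit Types (M : set E) (p u v : E).

(* c is a curve in M through p at time 0, with velocity u there. *)
Definition curve_through M p u (c : R -> E) : Prop :=
  [/\ \forall t \near (0 : R), M (c t), c 0 = p & is_derive (0 : R) 1 c u].

Definition tangent M p : {vspace E} :=
  xget 0%VS [set T : {vspace E} |
    forall u, u \in T <-> exists c, curve_through M p u c].

(* dF_p(u), for F defined on M and u tangent to M at p *)
Definition mderiv (W : normedModType R) M (F : E -> W) p u : W :=
  xget 0 [set w | forall c, curve_through M p u c ->
                    is_derive (0 : R) 1 (F \o c) w].

Definition Ck_on (W : normedModType R) (k : nat) M (F : E -> W) : Prop :=
  forall p, M p -> exists (U : set E) (G : E -> W),
    [/\ open U, U p, Ck k U G & forall q, U q -> M q -> G q = F q].

End Hypersurface.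

Section ConvexBody.
Context {R : realType} {n : nat}.
Local Notation E := 'rV[R]_n.
Implicit Types (K : set E) (p u v : E).

Definition unit_normal (F : E -> R) p : E :=
  (enorm (egrad F p))^-1 *: egrad F p.

(* The class K^oo_+.  The boundary of K is described near each of its points p
   by a C^oo defining function F of K, so that unit_normal F is the outer unit
   normal along it; the second fundamental form at p is then
   v |-> <d nu_p(v), v> on the tangent space, and its being positive definite
   says that all the principal curvatures are positive. *)
Definition smooth_curved_body K : Prop :=
  [/\ compact K, convex_set K, interior K 0 &
   forall p, bdry K p -> exists (U : set E) (F : E -> R),
     [/\ open U /\ U p, Cinfty U F,
         (forall q, U q -> (K q <-> F q <= 0)),
         egrad F p != 0 &
         forall v, v != 0 -> dot (egrad F p) v = 0 ->
           0 < dot ('D_v (unit_normal F) p) v]].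

Definition support_fun K (y : E) : R := sup [set dot y x | x in K].

Definition minkowski_gauge K (x : E) : R := inf [set t : R | 0 < t /\ K (t^-1 *: x)].

Definition dual_body K : set E := [set y | support_fun K y <= 1].

End ConvexBody.

Inductive domain :=
  | DualSphere      (* S^* *)
  | Boundary        (* bd K *)
  | PrimalSphere    (* S *)
  | DualBoundary.   (* bd K^* *)

Section CentroAffine.
Context {R : realType} {n : nat}.
Local Notation E := 'rV[R]_n.
Implicit Types (K : set E) (M : domain) (p u v : E) (f : E -> R) (X : E -> E).

Definition carrier K M : set E :=
  match M with
  | DualSphere | PrimalSphere => usphere
  | Boundary => bdry K
  | DualBoundary => bdry (dual_body K)
  end.

(* x_K^M : M -> bd K *)
Definition param K M : E -> E :=
  match M with
  | DualSphere | DualBoundary => egrad (support_fun K)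
  | Boundary => id
  | PrimalSphere => fun theta => (minkowski_gauge K theta)^-1 *: theta
  end.

(* T_K^{M1 -> M2} = (x_K^{M2})^-1 \o x_K^{M1} *)
Definition transition K M1 M2 : E -> E :=
  'pinv_(fun=> 0) (carrier K M2) (param K M2) \o param K M1.

Definition tspace K M p : {vspace E} := tangent (carrier K M) p.

Definition dparam K M p u : E := mderiv (carrier K M) (param K M) p u.

Definition conormal K M p : E :=
  xget 0 [set y | dot y (param K M p) = 1 /\
                  forall u, u \in tspace K M p -> dot y (dparam K M p u) = 0].

Definition ca_metric K M p u v : R :=
  dot (mderiv (carrier K M) (conormal K M) p u) (dparam K M p v).

(* ((nabla_K)_u X)(p), from the Gauss equation
   D_u dx(X) = dx(nabla_u X) - g_K(u, X) x. *)
Definition ca_connection K M u X p : E :=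
  xget 0 [set w | w \in tspace K M p /\
    mderiv (carrier K M) (fun q => dparam K M q (X q)) p u =
      dparam K M p w - ca_metric K M p u (X p) *: param K M p].

Definition ca_grad K M f p : E :=
  xget 0 [set w | w \in tspace K M p /\
    forall v, v \in tspace K M p ->
      ca_metric K M p w v = mderiv (carrier K M) f p v].

(* nabla_i X^i: the trace of u |-> nabla_u X in a basis of the tangent space *)
Definition ca_div K M X p : R :=
  let b := vbasis (tspace K M p) in
  \sum_i coord b i (ca_connection K M b`_i X p).

Definition ca_laplacian K M f p : R := ca_div K M (ca_grad K M f) p.

(* 1-homogeneous extension of a function on the dual sphere *)
Definition ext1 (h : E -> R) (y : E) : R := enorm y * h ((enorm y)^-1 *: y).

Definition D2 (h : E -> R) (theta u v : E) : R :=
  'D_u (fun y => 'D_v (ext1 h) y) theta.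

(* matrix of D^2 h at theta in a basis of the tangent space of the dual sphere *)
Definition D2mx (h : E -> R) (theta : E) :
    'M[R]_(\dim (tangent usphere theta)) :=
  let b := vbasis (tangent usphere theta) in
  \matrix_(i, j) D2 h theta b`_i b`_j.

Definition HBM K (z : E -> R) (theta : E) : R :=
  (\sum_i \sum_j invmx (D2mx (support_fun K) theta) i j *
                 D2mx (fun y => z y * support_fun K y) theta i j)
  - (n%:R - 1) * z theta.

(* An operator L on functions on the dual sphere, carried over to M:
   f |-> L (f \o T) \o T^-1 with T = T_K^{S^* -> M}. *)
Definition transport K M (L : (E -> R) -> E -> R) : (E -> R) -> E -> R :=
  fun f => L (f \o transition K DualSphere M) \o transition K M DualSphere.

End CentroAffine.

(* Main.v *)
Require Import Defs.
From HB Require Import structures.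
From mathcomp Require Import all_boot all_order all_algebra.
From mathcomp Require Import all_classical all_reals all_analysis.
From mathcomp Require Import ring lra.
Set Implicit Arguments.
Unset Strict Implicit.
Unset Printing Implicit Defensive.
Import Order.TTheory GRing.Theory Num.Theory.
Import numFieldNormedType.Exports.
Local Open Scope classical_set_scope.
Local Open Scope ring_scope.

(** Write [x(y)] for the gradient of the support function [h] of [K] at [y], that
is, the point of the body where [<y, .>] is maximal.  For a function [f] on the
dual sphere let [F] be its extension homogeneous of degree 0, so that [H = F h]
is the 1-homogeneous extension of [f h] and [grad H = F x + h grad F].  On the
tangent space at a unit vector [theta] let [S] and [S_H] be the Hessians of [h]
and [H]; [S] is the differential of [x].

The conormal is [theta / h], so the metric is [g(u, v) = <u, S v> / h].  The
gradient is therefore determined by [S (grad f) = h grad F = grad H - F x]: its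
image in [E] is again given by derivatives of [H] and [h].  Differentiating in the
direction [u] and comparing with the Gauss equation
[D_u (S grad f) = S (nabla_u grad f) - g(u, grad f) x], the terms in [x] cancel
since [g(u, grad f) = dF(u)], and what remains is
[nabla_u grad f = S^-1 S_H u - F u].  Its trace over the (n - 1)-dimensional
tangent space is the Hilbert-Brunn-Minkowski operator.  This is
[ca_connection_radial] and [ca_laplacian_radial].

The computation is made for all the domains of parametrization at once.  Each
of them is the image of the sphere under a map [sg], homogeneous of degree 0, with
[x] as its composite with the parametrization ([radial_chart_domain]): [sg y] is
[y / |y|] on the dual sphere, [x(y)] on the boundary, [x(y) / |x(y)|] on the
primal sphere and [y / h(y)] on the dual boundary.  Tangent vectors and derivatives
are defined through curves, and curves in [M] correspond to curves in the sphere
([curve_radial]), so that everything reduces to differentiation on the punctured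
space [E] of functions composed with [sg] ([mderiv_radial]).

The regularity of [x] comes from the defining functions of the boundary.
Positive curvature makes the maximizer unique ([maximizer_unique]), compactness
makes it depend continuously on [y] ([support_point_continuous]), and [x] inverts
the Gauss map, whose differential is injective by positive curvature.  A continuous
inverse of a smooth map with invertible differential is smooth
([differentiable_inverse], [Cinfty_inverse]), hence so are [x]
([Cinfty_support_point]) and [h].  The same principle shows that the spherical
curve of a differentiable curve in [M] is differentiable. *)

(** * Euclidean space and differentials *)

Section EuclideanProduct.
Context {R : realType} {n : nat}.
Local Notation E := 'rV[R]_n.
Implicit Types (u v w : E) (t : R).

Lemma dotC u v : dot u v = dot v u.
Proof. by apply: eq_bigr => i _; rewrite mulrC. Qed.

Lemma dotDr u v w : dot u (v + w) = dot u v + dot u w.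
Proof. by rewrite /dot -big_split; apply: eq_bigr => i _; rewrite mxE mulrDr. Qed.

Lemma dotDl u v w : dot (v + w) u = dot v u + dot w u.
Proof. by rewrite dotC dotDr !(dotC u). Qed.

Lemma dotZr t u v : dot u (t *: v) = t * dot u v.
Proof. by rewrite /dot mulr_sumr; apply: eq_bigr => i _; rewrite mxE mulrCA. Qed.

Lemma dotZl t u v : dot (t *: u) v = t * dot u v.
Proof. by rewrite dotC dotZr dotC. Qed.

Lemma dotNr u v : dot u (- v) = - dot u v.
Proof. by rewrite -scaleN1r dotZr mulN1r. Qed.

Lemma dotNl u v : dot (- u) v = - dot u v.
Proof. by rewrite dotC dotNr dotC. Qed.

Lemma dotBr u v w : dot u (v - w) = dot u v - dot u w.
Proof. by rewrite dotDr dotNr. Qed.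

Lemma dotBl u v w : dot (v - w) u = dot v u - dot w u.
Proof. by rewrite dotDl dotNl. Qed.

Lemma dot0r u : dot u 0 = 0.
Proof. by rewrite -(scale0r 0) dotZr mul0r. Qed.

Lemma dot0l u : dot 0 u = 0.
Proof. by rewrite dotC dot0r. Qed.

Fact dot_is_linear u : linear (dot u).
Proof. by move=> t v w; rewrite dotDr dotZr. Qed.

HB.instance Definition _ u := GRing.isLinear.Build R E R *:%R (dot u) (dot_is_linear u).

Lemma ler_norm_dot u v : `|dot u v| <= n%:R * (`|u| * `|v|).
Proof.
have coord (w : E) i : `|w 0 i| <= `|w|.
  rewrite [leRHS]/Num.Def.normr/= mx_normrE.
  exact: (le_bigmax _ (fun ij => `|w ij.1 ij.2|) (0, i)).
apply: le_trans (ler_norm_sum _ _ _) _.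
apply: (@le_trans _ _ (\sum_(i < n) `|u| * `|v|)).
  by apply: ler_sum => i _; rewrite normrM ler_pM.
by rewrite sumr_const card_ord mulr_natl.
Qed.

Lemma dot_deltal (i : 'I_n) u : dot (delta_mx 0 i) u = u 0 i.
Proof.
rewrite /dot (bigD1 i)//= big1 => [|j ji]; rewrite mxE !eqxx ?mul1r ?addr0//.
by rewrite (negbTE ji) mul0r.
Qed.

Lemma dot_ge0 u : 0 <= dot u u.
Proof. by apply: sumr_ge0 => i _; rewrite -expr2 sqr_ge0. Qed.

Lemma dot_eq0 u : (dot u u == 0) = (u == 0).
Proof.
apply/eqP/eqP => [|->]; last exact: dot0l.
move=> /psumr_eq0P u0; apply/rowP => i; rewrite mxE.
have /eqP : u 0 i * u 0 i = 0 by apply: u0 => // j _; rewrite -expr2 sqr_ge0.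
by rewrite mulf_eq0 orbb => /eqP.
Qed.

Lemma dot_gt0 u : (0 < dot u u) = (u != 0).
Proof. by rewrite lt0r dot_eq0 dot_ge0 andbT. Qed.

Lemma dot_inj u v : (forall w, dot u w = dot v w) -> u = v.
Proof.
by move=> uv; apply/eqP; rewrite -subr_eq0 -dot_eq0 dotBl uv subrr.
Qed.

Lemma enorm_ge0 u : 0 <= enorm u.
Proof. exact: sqrtr_ge0. Qed.

Lemma enorm_gt0 u : (0 < enorm u) = (u != 0).
Proof. by rewrite sqrtr_gt0 dot_gt0. Qed.

Lemma enorm0 : enorm (0 : E) = 0.
Proof. by rewrite /enorm dot0l sqrtr0. Qed.

Lemma sqr_enorm u : enorm u ^+ 2 = dot u u.
Proof. by rewrite sqr_sqrtr// dot_ge0. Qed.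

Lemma enormZ t u : 0 <= t -> enorm (t *: u) = t * enorm u.
Proof.
move=> t0; rewrite /enorm dotZl dotZr mulrA -expr2 sqrtrM ?sqr_ge0//.
by rewrite sqrtr_sqr ger0_norm.
Qed.

Lemma usphereE u : usphere u <-> dot u u = 1.
Proof.
rewrite /usphere/= -sqr_enorm; split=> [->|/eqP]; first by rewrite expr1n.
by rewrite sqrp_eq1 ?enorm_ge0// => /eqP.
Qed.

Lemma usphere_neq0 u : usphere u -> u != 0.
Proof. by rewrite -enorm_gt0 => ->. Qed.

Lemma usphere_normalize u : u != 0 -> usphere ((enorm u)^-1 *: u).
Proof.
rewrite -enorm_gt0 => u0; rewrite /usphere/= enormZ ?invr_ge0 ?ltW//.
by rewrite mulVf ?gt_eqF.
Qed.

(** Subtracting from [u] its component along [w] leaves a vector orthogonal to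
[w], hence to [u], hence to itself. *)
Lemma dot_parallel u w : (forall v, dot w v = 0 -> dot u v = 0) ->
  u = (dot u w / dot w w) *: w.
Proof.
move=> uw; apply/eqP; rewrite -subr_eq0 -dot_eq0; set t := _ / _.
have wv : dot w (u - t *: w) = 0.
  rewrite dotBr dotZr (dotC w u); have [->|w0] := eqVneq w 0.
    by rewrite !dot0r mulr0 subr0.
  by rewrite /t divfK ?subrr// dot_eq0.
by rewrite dotBl dotZl wv uw// mulr0 subrr.
Qed.

End EuclideanProduct.

Section Differentials.
Context {R : realType} {n : nat}.
Local Notation E := 'rV[R]_n.
Implicit Types U V W : normedModType R.

Lemma linear_rV_continuous W (L : {linear E -> W}) : continuous L.
Proof.
move=> x.
have -> : (L : E -> W) = (fun v => \sum_i v 0 i *: L (delta_mx 0 i)).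
  apply/funext => v; rewrite {1}[v]row_sum_delta linear_sum.
  by apply: eq_bigr => i _; rewrite linearZ.
apply: (cvg_big (@add_continuous _) (F := nbhs x)) => i _.
apply: cvgZr_tmp; exact: coord_continuous.
Qed.

Lemma diff_near V W (f : V -> W) x (e : R) : differentiable f x -> 0 < e ->
  \forall y \near x, `|f y - f x - 'd f x (y - x)| <= e * `|y - x|.
Proof.
move=> /diff_locally /eqaddoP df e0.
have : nbhs (0 : V) _ := df e e0; rewrite [nbhs _ _](near_shift x) sub0r /=.
by apply: filterS => z /=; rewrite !fctE /= subrK opprD addrA.
Qed.

Lemma near_diff V W (f : V -> W) (L : {linear V -> W}) x : continuous L ->
  (forall e : R, 0 < e ->
     \forall y \near x, `|f y - f x - L (y - x)| <= e * `|y - x|) ->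
  is_diff x f L.
Proof.
move=> cL fL; have fE : f \o shift x = cst (f x) + L +o_ 0 id.
  apply/eqaddoP => e e0.
  change (nbhs (0 : V)
    (fun h => `|(f \o shift x - (cst (f x) + L)) h| <= e * `|h|)).
  rewrite [nbhs _ _](near_shift x) sub0r /=.
  by apply: filterS (fL e e0) => z /=; rewrite !fctE /= subrK opprD addrA.
have dE := diff_unique cL fE.
by apply: DiffDef => //; apply/diff_locallyP; rewrite dE.
Qed.

Lemma differentiable_rVP V (f : V -> E) x :
  differentiable f x <-> forall i, differentiable (fun y => f y 0 i) x.
Proof.
split=> df => [i|].
  by apply: (@differentiable_comp _ _ _ _ f (fun u : E => u 0 i)) => //;
    exact: differentiable_coord.
have -> : f = \sum_i (fun y => f y 0 i *: (delta_mx 0 i : E)).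
  by apply/funext => y; rewrite fct_sumE; exact: row_sum_delta.
by apply: differentiable_sum => i; exact: differentiableZl.
Qed.

Lemma is_derive_rVP V (f : V -> E) x v df :
  is_derive x v f df <-> forall i, is_derive x v (fun y => f y 0 i) (df 0 i).
Proof.
split=> [[fv <-] i|fv].
  by split; [move/derivable_mxP: fv; apply | rewrite derive_mx// mxE].
have fdv : derivable f x v.
  by apply/derivable_mxP => i j; rewrite (ord1 i); case: (fv j).
by split=> //; rewrite derive_mx//; apply/rowP => i; rewrite mxE; case: (fv i).
Qed.

Lemma is_derive_line V W (f : V -> W) x v df :
  is_derive x v f df <-> is_derive (0 : R) 1 (fun t : R => f (t *: v + x)) df.
Proof.
suff E1 : 'D_v f x = 'D_1 (fun t : R => f (t *: v + x)) 0.
  by split=> -[fv <-]; split=> //;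
    [exact: (derivable1P f x v).1 | exact: (derivable1P f x v).2].
rewrite /derive; set g1 := fun h => h^-1 *: _; set g2 := fun h => h^-1 *: _.
suff -> : g1 = g2 by [].
apply/funext => h; rewrite /g1 /g2 /=.
by rewrite addr0 scale0r add0r [_%:A]mulr1.
Qed.

Lemma is_derive_diff V W (f : V -> W) x v : differentiable f x ->
  is_derive x v f ('d f x v).
Proof. by move=> df; split; [exact: diff_derivable | rewrite deriveE]. Qed.

Lemma is_derive_uniq V W (f : V -> W) x v d1 d2 :
  is_derive x v f d1 -> is_derive x v f d2 -> d1 = d2.
Proof. by move=> [_ <-] [_ <-]. Qed.

Lemma diff_val_derive V W (f : V -> W) x v d :
  differentiable f x -> is_derive x v f d -> 'd f x v = d.
Proof. by move=> df; apply: is_derive_uniq; exact: is_derive_diff. Qed.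

(** The chain rule for a map composed with a differentiable one: only the
directional derivative of the inner map is needed. *)
Lemma is_derive_chain V U W (g : V -> U) (f : U -> W) x v dg :
  differentiable f (g x) -> is_derive x v g dg ->
  is_derive x v (f \o g) ('d f (g x) dg).
Proof.
move=> df /is_derive_line [gv gE]; apply/is_derive_line.
have /derivable1_diffP dgl := gv.
pose c (t : R) := g (t *: v + x); have c0 : c 0 = g x by rewrite /c scale0r add0r.
have dfc : differentiable f (c 0) by rewrite c0.
have dfg : differentiable (f \o c) (0 : R) by exact: differentiable_comp.
have -> : 'd f (g x) dg = 'd (f \o c) (0 : R) 1.
  have <- : 'd c (0 : R) 1 = dg by rewrite -gE deriveE.
  rewrite -c0. by rewrite (diff_comp dgl dfc).
exact: is_derive_diff.
Qed.

Lemma is_derive_dot V (a b : V -> E) x v da db :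
  is_derive x v a da -> is_derive x v b db ->
  is_derive x v (fun y => dot (a y) (b y)) (dot da (b x) + dot (a x) db).
Proof.
move=> /is_derive_rVP va /is_derive_rVP vb.
have -> : (fun y => dot (a y) (b y)) =
    \sum_i ((fun y => a y 0 i) * (fun y => b y 0 i)).
  by apply/funext => y; rewrite fct_sumE.
apply: (is_derive_eq (is_derive_sum (fun i => is_deriveM (va i) (vb i)))).
rewrite /dot -big_split /=; apply: eq_bigr => i _.
by rewrite addrC; congr (_ + _); exact: mulrC.
Qed.

Lemma is_derive_scaler V (k : V -> R) (a : V -> E) x v dk da :
  is_derive x v k dk -> is_derive x v a da ->
  is_derive x v (fun y => k y *: a y) (dk *: a x + k x *: da).
Proof.
move=> vk /is_derive_rVP va; apply/is_derive_rVP => i.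
under eq_fun do rewrite mxE.
apply: (is_derive_eq (is_deriveM vk (va i))).
by rewrite !mxE addrC; congr (_ + _); exact: mulrC.
Qed.

Lemma is_derive_affine (x u : E) (s : R) :
  is_derive s 1 (fun t : R => x + t *: u) u.
Proof.
have du := is_derive_scaler (is_derive_id s 1) (is_derive_cst u s 1).
apply: (is_derive_eq (is_deriveD (is_derive_cst x s 1) du)).
by rewrite add0r scale1r scaler0 addr0.
Qed.

Lemma differentiable_dot V (a b : V -> E) x :
  differentiable a x -> differentiable b x ->
  differentiable (fun y => dot (a y) (b y)) x.
Proof.
move=> /differentiable_rVP da /differentiable_rVP db.
have -> : (fun y => dot (a y) (b y)) =
    \sum_i ((fun y => a y 0 i) * (fun y => b y 0 i)).
  by apply/funext => y; rewrite fct_sumE.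
by apply: differentiable_sum => i; exact: differentiableM.
Qed.

Lemma differentiable_scaler V (k : V -> R) (a : V -> E) x :
  differentiable k x -> differentiable a x ->
  differentiable (fun y => k y *: a y) x.
Proof.
move=> dk /differentiable_rVP da; apply/differentiable_rVP => i.
under eq_fun do rewrite mxE.
exact: differentiableM.
Qed.

Lemma near_eq_differentiable V W (f g : V -> W) x :
  {near x, f =1 g} -> differentiable f x -> is_diff x g ('d f x).
Proof.
move=> fg df; apply: near_diff; first exact: diff_continuous.
move=> e e0; have := diff_near df e0; have gx := nbhs_singleton fg.
by apply: filterS2 fg => y -> ; rewrite gx.
Qed.

Lemma continuous_rV V (f : V -> E) x :
  (forall i, {for x, continuous (fun y => f y 0 i)}) -> {for x, continuous f}.
Proof.
move=> cf; have -> : f = fun y => \sum_i (f y 0 i *: (delta_mx 0 i : E)).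
  by apply/funext => y; exact: row_sum_delta.
apply: (cvg_big (@add_continuous _) (F := nbhs x)) => i _.
by apply: cvgZr_tmp; exact: cf.
Qed.

End Differentials.

(** * Continuous inverses and mixed derivatives *)

Section InverseAndSchwarz.
Context {R : realType} {n : nat}.
Local Notation E := 'rV[R]_n.
Implicit Types U V W : normedModType R.

Lemma lin1_mx_unitP (L : {linear E -> E}) :
  lin1_mx L \in unitmx <-> forall v, L v = 0 -> v = 0.
Proof.
split=> [uA v|L0].
  rewrite -mul_rV_lin1 => /(congr1 (mulmxr (invmx (lin1_mx L)))) /=.
  by rewrite mulmxK// mul0mx.
rewrite -row_free_unit -kermx_eq0; apply/eqP/row_matrixP => i.
by rewrite row0; apply: L0; rewrite -mul_rV_lin1 -row_mul mulmx_ker row0.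
Qed.

Lemma linear_rV_inverse (L : {linear E -> E}) : (forall v, L v = 0 -> v = 0) ->
  exists G : {linear E -> E}, cancel L G /\ cancel G L.
Proof.
move=> /lin1_mx_unitP uA; exists (mulmxr (invmx (lin1_mx L))); split=> v /=.
  by rewrite -[L v]mul_rV_lin1 mulmxK.
by rewrite -[L _]mul_rV_lin1 mulmxKV.
Qed.

(** A continuous right inverse inherits differentiability: where the differential
of [f] is invertible, the increment of [g] controls the remainder of [f] along
[g], so that it is itself controlled by the increment of the variable.  Only
the values of [f] along [g] are compared, so that this applies to curves and to
maps into hypersurfaces; the continuity of [g] replaces the contraction argument
of the inverse function theorem. *)
Lemma differentiable_inverse V (f : E -> E) (g k : V -> E) y0 :
  {near y0, f \o g =1 k} -> {for y0, continuous g} ->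
  differentiable f (g y0) -> differentiable k y0 ->
  (forall v, 'd f (g y0) v = 0 -> v = 0) ->
  differentiable g y0.
Proof.
move=> fgk cg df dk /linear_rV_inverse[G [LG _]].
set L := 'd f (g y0) in LG *; set M : {linear V -> E} := G \o 'd k y0.
have cM : continuous M.
  move=> y; apply: (@continuous_comp _ _ _ ('d k y0) G); last exact: linear_rV_continuous.
  exact: diff_continuous.
suff : is_diff y0 g M by case.
apply: near_diff => // e e0.
have [c c0 Gc] := linear_lipschitz (@linear_rV_continuous _ _ _ G).
have [m m0 Mm] := linear_lipschitz cM.
(* [c * d <= 1/2] absorbs the increment of [g]; the other bound gives [e]. *)
pose d := Num.min (2 * c)^-1 (e / (c * (2 + 2 * m))).
have d0 : 0 < d.
  rewrite lt_min invr_gt0 mulr_gt0//= divr_gt0//.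
  by rewrite mulr_gt0// addr_gt0// mulr_gt0.
have fg := nbhs_singleton fgk.
have dcg : \forall y \near y0, `|f (g y) - f (g y0) - L (g y - g y0)| <= d * `|g y - g y0|.
  exact: (cg _ (diff_near df d0)).
apply: filterS3 fgk dcg (diff_near dk d0) => y fy.
rewrite [f (g y)]fy [f (g y0)]fg => rb sb.
set a := `|g y - g y0| in rb *; set b := `|y - y0| in sb *.
have Db : `|g y - g y0 - M (y - y0)| <= c * (d * a + d * b).
  have -> : g y - g y0 - M (y - y0) =
      G ((k y - k y0 - 'd k y0 (y - y0)) - (k y - k y0 - L (g y - g y0))).
    have subBB (p q w : E) : (p - q) - (p - w) = w - q.
      by rewrite opprB addrC addrA subrK.
    by rewrite subBB (linearB G) LG.
  apply: le_trans (Gc _) _; rewrite ler_pM2l// (le_trans (ler_normB _ _))//.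
  by rewrite addrC lerD.
have a_le : a <= `|g y - g y0 - M (y - y0)| + m * b.
  rewrite /a -[X in `|X|](subrK (M (y - y0))) (le_trans (ler_normD _ _))//.
  by rewrite lerD.
have cd : c * d <= 2^-1.
  have : d <= (2 * c)^-1 by rewrite ge_min lexx.
  by rewrite -(ler_pM2l c0) invfM mulrCA divff ?gt_eqF// mulr1.
have cde : c * d * (2 + 2 * m) <= e.
  have : d <= e / (c * (2 + 2 * m)) by rewrite ge_min lexx orbT.
  by rewrite ler_pdivlMr ?mulr_gt0 ?addr_gt0 ?mulr_gt0// mulrCA mulrA.
have b0 : 0 <= b by exact: normr_ge0.
have a0 : 0 <= a by exact: normr_ge0.
have ab : a <= (1 + 2 * m) * b by nra.
apply: (le_trans Db).
have : c * (d * a + d * b) <= c * d * (2 + 2 * m) * b.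
  have cd0 : 0 <= c * d by rewrite mulr_ge0 ?ltW.
  have abb : a + b <= (2 + 2 * m) * b by lra.
  by rewrite -mulrDr mulrA -[leRHS]mulrA; exact: ler_wpM2l.
move=> /le_trans; apply; exact: ler_wpM2r.
Qed.

Lemma is_derive_inverse V (f : E -> E) (g k : V -> E) y0 v :
  {near y0, f \o g =1 k} -> differentiable f (g y0) ->
  differentiable g y0 -> 'd f (g y0) ('d g y0 v) = 'D_v k y0.
Proof.
move=> fgk df dg; have := is_derive_chain df (is_derive_diff v dg).
by move=> /(near_eq_is_derive fgk) [_ ->].
Qed.

(** The mean value theorem along [u] turns the second difference into [t] times
an increment of the derivative of [h] along [u] in the direction [v], which the
differentiability of that derivative at [x] estimates. *)
Lemma second_difference (h : E -> R) x u v (e : R) :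
  (\forall y \near x, differentiable h y) -> differentiable ('D_u h) x ->
  0 < e -> exists2 r : R, 0 < r & forall t, 0 < t < r ->
   `|h (x + t *: u + t *: v) - h (x + t *: u) - h (x + t *: v) + h x
      - t ^+ 2 * 'D_v ('D_u h) x| <= e * t ^+ 2.
Proof.
move=> dh dP e0; pose N := 2 * (`|u| + `|v|) + 1.
have N0 : 0 < N by rewrite ltr_pwDr// mulr_ge0// addr_ge0.
have eN : 0 < e / N by rewrite divr_gt0.
have : nbhs x (fun y => differentiable h y /\
    `|'D_u h y - 'D_u h x - 'd ('D_u h) x (y - x)| <= e / N * `|y - x|).
  exact: filterI dh (diff_near dP eN).
move=> /nbhs_ballP[r /= r0 rb].
exists (r / N); first by rewrite divr_gt0.
move=> t /andP[t0 tr]; have tN : t * N < r by rewrite -ltr_pdivlMr.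
have near_pt (a b : R) : 0 <= a <= t -> 0 <= b <= t ->
    ball x r (x + (a *: u + b *: v)) /\ `|a *: u + b *: v| <= t * (`|u| + `|v|).
  move=> /andP[a0 at_] /andP[b0 bt].
  have le1 : `|a *: u + b *: v| <= t * (`|u| + `|v|).
    rewrite (le_trans (ler_normD _ _))// mulrDr !normrZ !ger0_norm//.
    by rewrite lerD// ler_wpM2r.
  split=> //; rewrite -ball_normE /= opprD addNKr normrN.
  apply: le_lt_trans le1 _; apply: le_lt_trans tN; rewrite ler_pM2l//.
  have := normr_ge0 u; have := normr_ge0 v; rewrite /N; lra.
pose phi s := h (x + (s *: u + t *: v)) - h (x + (s *: u + 0 *: v)).
pose P := 'D_u h.
have dphi (s : R) : 0 <= s <= t ->
    is_derive s 1 phi (P (x + (s *: u + t *: v)) - P (x + (s *: u + 0 *: v))).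
  move=> st; have line (b : R) : 0 <= b <= t ->
      is_derive s 1 (fun z : R => h (x + (z *: u + b *: v))) (P (x + (s *: u + b *: v))).
    move=> bt; have [bl _] := near_pt s b st bt; have [dhp _] := rb _ bl.
    have dl : is_derive s 1 (fun z : R => x + (z *: u + b *: v)) u.
      have -> : (fun z : R => x + (z *: u + b *: v)) = fun z => (x + b *: v) + z *: u.
        by apply/funext => z; rewrite -addrA (addrC (b *: v)).
      exact: is_derive_affine.
    have := is_derive_chain (g := fun z : R => x + (z *: u + b *: v)) (x := s) dhp dl.
    by rewrite -deriveE.
  have t1 : 0 <= t <= t by rewrite (ltW t0) /=.
  have t2 : (0 : R) <= 0 <= t by rewrite lexx ltW.
  exact: (is_deriveB (line t t1) (line 0 t2)).
pose psi s := P (x + (s *: u + t *: v)) - P (x + (s *: u + 0 *: v)).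
have [||c] := @MVT R phi psi 0 t t0.
- move=> s; rewrite in_itv /= => /andP[s0 st]; by apply: dphi; rewrite !ltW.
- apply: derivable_within_continuous => s; rewrite in_itv /= => st.
  by have [] := dphi s st.
rewrite in_itv /= /psi => /andP[c0 ct] phiE.
have -> : h (x + t *: u + t *: v) - h (x + t *: u) - h (x + t *: v) + h x
    = phi t - phi 0.
  by rewrite /phi !scale0r !addr0 !add0r addrA; ring.
rewrite phiE subr0.
have ct' : 0 <= c <= t by rewrite !ltW.
have t1 : 0 <= t <= t by rewrite (ltW t0) /=.
have t2 : (0 : R) <= 0 <= t by rewrite lexx ltW.
have [b1 n1] := near_pt c t ct' t1.
have [b2 n2] := near_pt c 0 ct' t2.
have lin (a b : R) : 'd P x (a *: u + b *: v) = a * 'd P x u + b * 'd P x v.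
  by rewrite linearD !linearZ.
have [_ r1] := rb _ b1; have [_ r2] := rb _ b2.
rewrite [x + _ - x]addrAC subrr add0r lin in r1.
rewrite [x + _ - x]addrAC subrr add0r lin mul0r addr0 in r2.
rewrite (deriveE _ dP) -/P.
rewrite -/P in r1 r2.
set A := P (x + _) in r1 *; set B := P (x + _) in r2 *.
have dAB : `|A - B - t * 'd P x v| <= e * t.
  have -> : A - B - t * 'd P x v = (A - P x - (c * 'd P x u + t * 'd P x v)) -
      (B - P x - c * 'd P x u) by ring.
  rewrite (le_trans (ler_normB _ _))// (le_trans (lerD r1 r2))//.
  rewrite -mulrDr -mulrA ler_pM2l// mulrC ler_pdivrMr// (le_trans (lerD n1 n2))//.
  by rewrite -mulrDr ler_pM2l// /N -mulr2n mulr_natl ler_wpDr.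
have -> : (A - B) * t - t ^+ 2 * 'd P x v = (A - B - t * 'd P x v) * t by ring.
by rewrite normrM (gtr0_norm t0) expr2 mulrA ler_pM2r.
Qed.

(** Both mixed derivatives are the limit of the same second difference. *)
Lemma derive_symmetric (h : E -> R) x u v :
  (\forall y \near x, differentiable h y) ->
  differentiable ('D_u h) x -> differentiable ('D_v h) x ->
  'D_v ('D_u h) x = 'D_u ('D_v h) x.
Proof.
move=> dh du dv; apply/eqP; rewrite -subr_eq0 -normr_le0.
apply/ler_addgt0Pl => e e0; rewrite addr0.
have e20 : 0 < e / 2 by rewrite divr_gt0.
have [r r0 hr] := second_difference v dh du e20.
have [s s0 hs] := second_difference u dh dv e20.
pose t := Num.min r s / 2.
have t0 : 0 < t by rewrite divr_gt0// lt_min r0.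
have trs : t < Num.min r s by rewrite /t ltr_pdivrMr// ltr_pMr ?ltr1n// lt_min r0.
have tr : 0 < t < r by rewrite t0 (lt_le_trans trs)// ge_min lexx.
have ts : 0 < t < s by rewrite t0 (lt_le_trans trs)// ge_min lexx orbT.
have tt : 0 < t ^+ 2 by rewrite exprn_gt0.
rewrite -(ler_pM2l tt) -[X in X * `|_|](gtr0_norm tt) -normrM.
have := hs _ ts; rewrite [_ + _ + t *: u]addrAC [X in X + h x]addrAC => r2.
have := hr _ tr; move: r2.
set Q := _ + h x; set D1 := 'D_v _ _; set D2 := 'D_u _ _ => r2 r1.
have -> : t ^+ 2 * (D1 - D2) = (Q - t ^+ 2 * D2) - (Q - t ^+ 2 * D1) by ring.
rewrite (le_trans (ler_normB _ _))// (le_trans (lerD r2 r1))//.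
by rewrite -mulrDl -splitr mulrC.
Qed.

End InverseAndSchwarz.

(** * Maps of class C^k *)

Section CkCalculus.
Context {R : realType} {n : nat}.
Local Notation E := 'rV[R]_n.
Implicit Types (W : normedModType R) (k m : nat) (U V : set E).

Lemma Ck_continuous W k U (F : E -> W) p : Ck k U F -> U p -> {for p, continuous F}.
Proof.
case: k => [|k] /=; first by move=> h /h.
by move=> [h _] /h; exact: differentiable_continuous.
Qed.

Lemma Ck_local W k U (F : E -> W) :
  (forall p, U p -> exists V, V p /\ Ck k V F) -> Ck k U F.
Proof.
elim: k F => [|k IH] F h /=.
  by move=> p /h[V [Vp]]; apply.
split=> [p /h[V [Vp [dF _]]]|v]; first exact: dF.
by apply: IH => p /h[V [Vp [_ cF]]]; exists V; split=> //; exact: cF.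
Qed.

Lemma Ck_sub W k U V (F : E -> W) : U `<=` V -> Ck k V F -> Ck k U F.
Proof. by move=> UV cF; apply: Ck_local => p /UV Vp; exists V. Qed.

Lemma Ck_weaken W k U (F : E -> W) : Ck k.+1 U F -> Ck k U F.
Proof.
elim: k F => [|k IH] F /=.
  by move=> [dF _] p /dF; exact: differentiable_continuous.
by move=> [dF cF]; split=> // v; apply: IH; exact: cF.
Qed.

Lemma Ck_eq W k U (F G : E -> W) : open U -> (forall p, U p -> F p = G p) ->
  Ck k U F -> Ck k U G.
Proof.
move=> oU; elim: k F G => [|k IH] F G FG.
  move=> cF p Up; have nFG : {near p, F =1 G}.
    by apply: filterS (open_nbhs_nbhs (conj oU Up)) => q /FG.
  change (G q @[q --> p] --> G p); rewrite -FG//; apply: cvg_trans (cF p Up).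
  exact: near_eq_cvg nFG.
have nFG p : U p -> {near p, F =1 G}.
  by move=> Up; apply: filterS (open_nbhs_nbhs (conj oU Up)) => q /FG.
move=> [dF cF]; split=> [p Up|v].
  by case: (near_eq_differentiable (nFG p Up) (dF p Up)).
by apply: IH (cF v) => p Up; exact: near_eq_derive (nFG p Up).
Qed.

Lemma Ck_succ W k U (F : E -> W) (dF : E -> E -> W) : open U ->
  (forall p, U p -> differentiable F p) ->
  (forall p v, U p -> is_derive p v F (dF v p)) ->
  (forall v, Ck k U (dF v)) -> Ck k.+1 U F.
Proof.
move=> oU diffF derF cF; split=> // v.
by apply: Ck_eq (cF v) => // p Up; case: (derF p v Up).
Qed.

Lemma Ck_is_derive W k U (F : E -> W) p v : Ck k.+1 U F -> U p ->
  is_derive p v F ('D_v F p).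
Proof. by move=> [dF _] Up; apply: derivableP; apply: diff_derivable; exact: dF. Qed.

Lemma Ck_cst W k U (a : W) : Ck k U (cst a).
Proof.
elim: k a => [|k IH] a /=; first by move=> p _; exact: cst_continuous.
split=> [p _|v]; first exact: differentiable_cst.
by under eq_fun do rewrite derive_cst; exact: IH.
Qed.

Lemma Ck_linear W k U (L : {linear E -> W}) : Ck k U L.
Proof.
have cL := @linear_rV_continuous R n W L.
case: k => [|k] /=; first by move=> p _; exact: cL.
split=> [p _|v]; first exact: linear_differentiable.
have -> : (fun p => 'D_v L p) = cst (L v).
  apply/funext => p; rewrite deriveE ?diff_lin//.
  exact: linear_differentiable.
exact: Ck_cst.
Qed.

Lemma CkD W k U (F G : E -> W) : open U -> Ck k U F -> Ck k U G ->
  Ck k U (fun p => F p + G p).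
Proof.
move=> oU; elim: k F G => [|k IH] F G cF cG.
  by move=> p Up; exact: (cvgD (cF p Up) (cG p Up)).
apply: (@Ck_succ _ _ _ _ (fun v p => 'D_v F p + 'D_v G p)) => //.
- by move=> p Up; apply: differentiableD; [exact: cF.1 | exact: cG.1].
- move=> p v Up.
  exact: (is_deriveD (Ck_is_derive v cF Up) (Ck_is_derive v cG Up)).
- by move=> v; apply: IH; [exact: cF.2 | exact: cG.2].
Qed.

Lemma CkM k U (F G : E -> R) : open U -> Ck k U F -> Ck k U G ->
  Ck k U (fun p => F p * G p).
Proof.
move=> oU; elim: k F G => [|k IH] F G cF cG.
  by move=> p Up; exact: (cvgM (cF p Up) (cG p Up)).
apply: (@Ck_succ _ _ _ _ (fun v p => F p * 'D_v G p + G p * 'D_v F p)) => //.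
- by move=> p Up; apply: differentiableM; [exact: cF.1 | exact: cG.1].
- move=> p v Up.
  exact: (is_deriveM (Ck_is_derive v cF Up) (Ck_is_derive v cG Up)).
- move=> v; apply: CkD => //; apply: IH.
  + exact: Ck_weaken. + exact: cG.2. + exact: Ck_weaken. + exact: cF.2.
Qed.

Lemma CkZ k U c (F : E -> R) : open U -> Ck k U F -> Ck k U (fun p => c * F p).
Proof. by move=> oU; apply: CkM => //; exact: Ck_cst. Qed.

Lemma Ck_sum (I : Type) (r : seq I) (P : pred I) k U (F : I -> E -> R) :
  open U -> (forall i, P i -> Ck k U (F i)) ->
  Ck k U (fun p => \sum_(i <- r | P i) F i p).
Proof.
move=> oU cF; elim: r => [|i r IH].
  by under eq_fun do rewrite big_nil; exact: Ck_cst.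
case Pi : (P i); under eq_fun do rewrite big_cons Pi; last exact: IH.
by apply: CkD => //; exact: cF.
Qed.

Lemma Ck_prod (I : Type) (r : seq I) (P : pred I) k U (F : I -> E -> R) :
  open U -> (forall i, P i -> Ck k U (F i)) ->
  Ck k U (fun p => \prod_(i <- r | P i) F i p).
Proof.
move=> oU cF; elim: r => [|i r IH].
  by under eq_fun do rewrite big_nil; exact: Ck_cst.
case Pi : (P i); under eq_fun do rewrite big_cons Pi; last exact: IH.
by apply: CkM => //; exact: cF.
Qed.

Lemma Ck_inv k U (F : E -> R) : open U -> (forall p, U p -> F p != 0) ->
  Ck k U F -> Ck k U (fun p => (F p)^-1).
Proof.
move=> oU F0; elim: k => [|k IH] cF.
  by move=> p Up; exact: (cvgV (F0 p Up) (cF p Up)).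
apply: (@Ck_succ _ _ _ _ (fun v p => - 1 * ((F p)^-1 * (F p)^-1 * 'D_v F p))) => //.
- by move=> p Up; apply: differentiableV; [exact: cF.1 | exact: F0].
- move=> p v Up; have dF := Ck_is_derive v cF Up.
  have [Fp0 dv] := (F0 p Up, ex_derive (is_derive := dF)).
  split; first exact: derivableV.
  by rewrite deriveV// expr2 invfM mulN1r scaleNr.
- move=> v; apply: CkZ => //; have cV := IH (Ck_weaken cF).
  by apply: CkM => //; [exact: CkM | exact: cF.2].
Qed.

Lemma Ck_rVP k U (F : E -> E) : open U ->
  Ck k U F <-> forall i, Ck k U (fun p => F p 0 i).
Proof.
move=> oU; elim: k F => [|k IH] F.
  split=> cF => [i p Up|p Up]; last by apply: continuous_rV => i; exact: cF.
  apply: (@continuous_comp _ _ _ F (fun u : E => u 0 i)); first exact: cF.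
  exact: coord_continuous.
split=> [[dF cF] i|cF].
  apply: (@Ck_succ _ _ _ _ (fun v p => 'D_v F p 0 i)) => //.
  - by move=> p /dF /differentiable_rVP.
  - move=> p v Up; apply: (is_derive_rVP _ _ _ _).1.
    by apply: derivableP; apply: diff_derivable; exact: dF.
  - by move=> v; exact: ((IH _).1 (cF v)).
split=> [p Up|v].
  by apply/differentiable_rVP => i; exact: (cF i).1.
apply/IH => i; apply: Ck_eq ((cF i).2 v) => // p Up.
have : derivable F p v.
  by apply/derivable_mxP => a j; rewrite (ord1 a); exact: diff_derivable ((cF j).1 p Up).
by move=> dF; rewrite derive_mx// mxE.
Qed.

Lemma Ck_scaler k U (c : E -> R) (F : E -> E) : open U -> Ck k U c -> Ck k U F ->
  Ck k U (fun p => c p *: F p).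
Proof.
move=> oU cc /(Ck_rVP _ _ oU) cF; apply/(Ck_rVP _ _ oU) => i.
by under eq_fun do rewrite mxE; exact: CkM.
Qed.

Lemma Ck_dot k U (F G : E -> E) : open U -> Ck k U F -> Ck k U G ->
  Ck k U (fun p => dot (F p) (G p)).
Proof.
move=> oU /(Ck_rVP _ _ oU) cF /(Ck_rVP _ _ oU) cG.
by apply: Ck_sum => // i _; exact: CkM.
Qed.

Lemma Ck_id k U : Ck k U (@id E).
Proof. exact: (Ck_linear _ _ (idfun : {linear E -> E})). Qed.

Lemma differentiable_enorm p : p != 0 -> differentiable (@enorm R n) p.
Proof.
move=> p0; have pp : 0 < dot p p by rewrite dot_gt0.
apply: (@differentiable_comp _ _ _ _ (fun q : E => dot q q)).
  exact: differentiable_dot.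
by apply/derivable1_diffP; case: (is_derive1_sqrt pp).
Qed.

Lemma is_derive_enorm p v : p != 0 ->
  is_derive p v (@enorm R n) ((enorm p)^-1 * dot p v).
Proof.
move=> p0; have pp : 0 < dot p p by rewrite dot_gt0.
have ds := is_derive1_sqrt pp.
have dsq : differentiable (@Num.sqrt R) (dot p p).
  by apply/derivable1_diffP; case: ds.
have := is_derive_chain (g := fun q : E => dot q q) dsq
  (is_derive_dot (is_derive_id p v) (is_derive_id p v)).
move=> /is_derive_eq; apply.
have -> : dot v p + dot p v = (dot v p + dot p v)%:A by rewrite [RHS]mulr1.
rewrite linearZ /= (diff_val_derive dsq ds) (dotC v) -mulr2n.
have scaleE (a b : R) : a *: b = a * b by [].
by rewrite scaleE -[dot p v *+ 2]mulr_natr invfM mulrA mulfK ?pnatr_eq0// mulrC.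
Qed.

Lemma Ck_enorm k U : open U -> (forall p, U p -> p != 0) ->
  Ck k U (@enorm R n).
Proof.
move=> oU U0; elim: k => [|k IH].
  by move=> p /U0 /differentiable_enorm /differentiable_continuous.
apply: (@Ck_succ _ _ _ _ (fun v p => (enorm p)^-1 * dot p v)) => //.
- by move=> p /U0; exact: differentiable_enorm.
- by move=> p v /U0; exact: is_derive_enorm.
- move=> v; apply: CkM => //.
    by apply: Ck_inv => // p Up; rewrite gt_eqF// enorm_gt0 U0.
  by apply: Ck_dot => //; [exact: Ck_id | exact: Ck_cst].
Qed.

Lemma Ck_comp k U V (G : E -> R) (F : E -> E) : open U -> open V ->
  (forall p, U p -> V (F p)) -> Ck k V G -> Ck k U F ->
  Ck k U (G \o F).
Proof.
move=> oU oV FV; elim: k G F FV => [|k IH] G F FV cG cF.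
  by move=> p Up; apply: continuous_comp; [exact: cF | apply: cG; exact: FV].
apply: (@Ck_succ _ _ _ _ (fun v p => \sum_i 'D_v F p 0 i * 'D_(delta_mx 0 i) G (F p))) => //.
- move=> p Up; apply: differentiable_comp; first exact: cF.1.
  by apply: cG.1; exact: FV.
- move=> p v Up; have dG : differentiable G (F p) by apply: cG.1; exact: FV.
  apply: (is_derive_eq (is_derive_chain dG (Ck_is_derive v cF Up))).
  rewrite [X in 'd G _ X]row_sum_delta linear_sum.
  by apply: eq_bigr => i _; rewrite linearZ (deriveE _ dG).
- move=> v; apply: Ck_sum => // i _; apply: CkM => //.
    exact: ((Ck_rVP _ _ oU).1 (cF.2 v)).
  by apply: (IH _ F FV (cG.2 _)); exact: Ck_weaken.
Qed.

Lemma Ck_det k U m (A : E -> 'M[R]_m) : open U ->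
  (forall i j, Ck k U (fun p => A p i j)) -> Ck k U (fun p => \det (A p)).
Proof.
move=> oU cA; apply: Ck_sum => // s _; apply: CkZ => //.
exact: Ck_prod.
Qed.

Lemma Ck_invmx k U m (A : E -> 'M[R]_m) : open U ->
  (forall p, U p -> A p \in unitmx) ->
  (forall i j, Ck k U (fun p => A p i j)) ->
  forall i j, Ck k U (fun p => invmx (A p) i j).
Proof.
move=> oU uA cA i j.
apply: (@Ck_eq _ _ _ (fun p => (\det (A p))^-1 * cofactor (A p) j i)) => //.
  by move=> p Up; rewrite /invmx uA// !mxE.
apply: CkM => //.
  apply: Ck_inv => //; first by move=> p /uA; rewrite unitmxE unitfE.
  exact: Ck_det.
apply: CkZ => //; apply: Ck_det => // a b.
by under eq_fun do rewrite !mxE; exact: cA.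
Qed.

(** The implicit derivative [D g = (J f)^-1 (D k)] of a right inverse is as
smooth as [g], so the regularity of [g] bootstraps from continuity. *)
Lemma Cinfty_inverse U V (f g k : E -> E) : open U -> open V ->
  (forall p, U p -> V (g p)) -> (forall p, U p -> f (g p) = k p) ->
  (forall p, U p -> {for p, continuous g}) ->
  Cinfty V f -> Cinfty U k ->
  (forall p v, U p -> 'd f (g p) v = 0 -> v = 0) ->
  Cinfty U g.
Proof.
move=> oU oV gV fgk cg cf ck inj.
have nfgk p : U p -> {near p, f \o g =1 k}.
  by move=> Up; apply: filterS (open_nbhs_nbhs (conj oU Up)) => q /fgk.
have df q : V q -> differentiable f q by exact: (cf 1%N).1.
have dk q : U q -> differentiable k q by exact: (ck 1%N).1.
have dg p : U p -> differentiable g p.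
  move=> Up; apply: (differentiable_inverse (nfgk p Up)) => //.
  - exact: cg. - exact/df/gV. - exact: dk.
  - by move=> v; exact: inj.
pose J q : 'M[R]_n := lin1_mx ('d f q).
have uJ p : U p -> J (g p) \in unitmx.
  by move=> Up; apply/lin1_mx_unitP => v; exact: inj.
have gE p v : U p -> 'd g p v = 'D_v k p *m invmx (J (g p)).
  move=> Up; rewrite -(is_derive_inverse v (nfgk p Up) (df _ (gV _ Up)) (dg p Up)).
  by rewrite -[X in _ = X *m _]mul_rV_lin1 mulmxK// uJ.
elim=> [|m IH]; first exact: cg.
apply: (@Ck_succ _ _ _ _ (fun v p => 'D_v k p *m invmx (J (g p)))) => //.
  by move=> p v Up; rewrite -gE//; apply: is_derive_diff; exact: dg.
move=> v; apply/(Ck_rVP _ _ oU) => j; under eq_fun do rewrite mxE.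
apply: Ck_sum => // i _; apply: CkM => //.
  exact: ((Ck_rVP _ _ oU).1 ((ck m.+1).2 v)).
apply: Ck_invmx => // a b.
apply: (@Ck_eq _ _ _ ((fun q => 'D_(delta_mx 0 a) f q 0 b) \o g)) => //.
  by move=> p Up; rewrite /= deriveE ?mxE//; exact/df/gV.
apply: (Ck_comp oU oV) => //.
exact: ((Ck_rVP _ _ oV).1 ((cf m.+1).2 _)).
Qed.

End CkCalculus.

(** * Boundary points of convex bodies *)

Section NearLemmas.
Context {R : realType} {n : nat}.
Local Notation E := 'rV[R]_n.

Lemma line_continuous (x v : E) (t : R) : {for t, continuous (fun s : R => x + s *: v)}.
Proof.
apply: differentiable_continuous; apply/derivable1_diffP.
by case: (is_derive_affine x v t).
Qed.

Lemma near_line (x v : E) (A : set E) : nbhs x A ->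
  \forall t \near (0 : R), A (x + t *: v).
Proof.
by move=> nA; apply: (line_continuous (t := 0)); rewrite scale0r addr0.
Qed.

Lemma near0_gt0 (A : set R) : nbhs (0 : R) A -> exists2 t : R, 0 < t < 1 & A t.
Proof.
move=> /nbhs_ballP[r /= r0 rA]; pose t := Num.min r 1 / 2.
have m0 : 0 < Num.min r 1 by rewrite lt_min r0 ltr01.
have tm : t < Num.min r 1 by rewrite /t ltr_pdivrMr// ltr_pMr// ltr1n.
exists t; first by rewrite divr_gt0//= (lt_le_trans tm)// ge_min lexx orbT.
apply: rA; rewrite -ball_normE /= sub0r normrN gtr0_norm ?divr_gt0//.
by rewrite (lt_le_trans tm)// ge_min lexx.
Qed.

Lemma near0_gt0_and (A B : set R) : nbhs (0 : R) A -> nbhs (0 : R) B ->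
  exists2 t : R, 0 < t < 1 & A t /\ B t.
Proof. by move=> nA nB; exact: (near0_gt0 (filterI nA nB)). Qed.

Lemma diff_lt0_near (F : E -> R) x v : differentiable F x -> 'd F x v < 0 ->
  \forall t \near (0 : R), 0 < t -> F (x + t *: v) < F x.
Proof.
move=> dF Fv; have v0 : v != 0.
  by apply: contraTneq Fv => ->; rewrite linear0 ltxx.
pose e := - 'd F x v / (2 * `|v|).
have nv : 0 < `|v| by rewrite normr_gt0.
have e0 : 0 < e by rewrite divr_gt0 ?oppr_gt0// mulr_gt0.
apply: filterS (near_line v (diff_near dF e0)) => t /=.
rewrite [x + _ - x]addrAC subrr add0r linearZ /= normrZ => h t0.
move: h; rewrite (gtr0_norm t0) => /(le_trans (ler_norm _)).
have -> : e * (t * `|v|) = - (t * 'd F x v) / 2.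
  by rewrite /e; field; rewrite gt_eqF.
have tF : t * 'd F x v < 0 by rewrite pmulr_rlt0.
change (t *: 'd F x v) with (t * 'd F x v); lra.
Qed.

Lemma egradE (F : E -> R) p v : differentiable F p -> dot (egrad F p) v = 'd F p v.
Proof.
move=> dF; rewrite [in RHS](row_sum_delta v) linear_sum; apply: eq_bigr => i _.
by rewrite linearZ mxE deriveE// mulrC.
Qed.

Lemma Ck_egrad k (U : set E) (F : E -> R) : open U -> Ck k.+1 U F -> Ck k U (egrad F).
Proof.
move=> oU cF; apply/(Ck_rVP _ _ oU) => i; under eq_fun do rewrite mxE.
exact: cF.2.
Qed.

Lemma open_preimage_on (W : topologicalType) (U : set E) (B : set W) (f : E -> W) :
  open U -> open B -> (forall p, U p -> {for p, continuous f}) ->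
  open (U `&` f @^-1` B).
Proof.
move=> oU oB cf; apply: (continuous_inP f oU).1 => // p.
by rewrite inE; exact: cf.
Qed.

Lemma open_neq0 (W : normedModType R) : open [set x : W | x != 0].
Proof.
have -> : [set x : W | x != 0] = ~` [set 0].
  by apply/seteqP; split=> x /= /eqP.
exact/closed_openC/accessible_closed_set1/hausdorff_accessible/norm_hausdorff.
Qed.

Definition normalize (y : E) : E := (enorm y)^-1 *: y.

Lemma Ck_normalized k (U : set E) (F : E -> E) : open U ->
  (forall p, U p -> F p != 0) -> Ck k U F -> Ck k U (fun p => normalize (F p)).
Proof.
move=> oU F0 cF; apply: (Ck_scaler oU _ cF).
have o0 : open [set y : E | y != 0] := @open_neq0 E.
have ce : Ck k [set y : E | y != 0] (@enorm R n) by exact: Ck_enorm.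
apply: (Ck_inv (F := @enorm R n \o F) oU _ (Ck_comp oU o0 F0 ce cF)) => p Up.
by rewrite /= gt_eqF// enorm_gt0 F0.
Qed.

End NearLemmas.

Section SupportPoint.
Context {R : realType} {n : nat}.
Local Notation E := 'rV[R]_n.
Implicit Types (K : set E) (p u v x y : E).

Definition maximizes K y x := K x /\ forall q, K q -> dot y q <= dot y x.

Definition support_point K y := xget 0 [set x | maximizes K y x].

(** [F] is a defining function of [K] over [U], as in the definition of a
smooth curved body, with [U] small enough to contain no critical point of [F];
the unit normal of the boundary then extends smoothly to [U]. *)
Definition chart K (U : set E) (F : E -> R) :=
  [/\ open U, Cinfty U F, forall q, U q -> (K q <-> F q <= 0) &
      forall q, U q -> egrad F q != 0].

Lemma Cinfty_unit_normal (U : set E) (F : E -> R) : open U -> Cinfty U F ->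
  (forall q, U q -> egrad F q != 0) -> Cinfty U (unit_normal F).
Proof. by move=> oU cF F0 k; exact: Ck_normalized oU F0 (Ck_egrad oU (cF k.+1)). Qed.

Lemma chart_bdry_eq0 K U F p : chart K U F -> U p -> bdry K p -> K p -> F p = 0.
Proof.
move=> [oU cF KF _] Up [_ nK] Kp; apply/eqP; rewrite eq_le (KF p Up).1//= leNgt.
apply/negP => Fp0; apply: nK.
have cFp : {for p, continuous F} := Ck_continuous (cF 0%N) Up.
have Fq : \forall q \near p, F q < 0 := cFp _ (lt_nbhsl Fp0).
apply: filterS2 Fq (open_nbhs_nbhs (conj oU Up)) => q /ltW Fq Uq.
exact/(KF q Uq).
Qed.

Lemma maximizes_bdry K y x : y != 0 -> maximizes K y x -> bdry K x.
Proof.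
move=> y0 [Kx xmax]; split; first exact: subset_closure.
move=> /(near_line y) /near0_gt0[t /andP[t0 _]] /xmax.
by rewrite dotDr dotZr gerDl leNgt mulr_gt0 ?dot_gt0.
Qed.

(** Moving into a direction that decreases [F] stays inside the body, hence
cannot increase [<y, .>]; so [y] is a positive multiple of the gradient of [F]. *)
Lemma maximizes_unit_normal K U F y x : chart K U F -> U x -> y != 0 ->
  maximizes K y x -> unit_normal F x = (enorm y)^-1 *: y.
Proof.
move=> [oU cF KF F0] Ux y0 [Kx xmax].
have dF : differentiable F x := (cF 1%N).1 x Ux.
set a := egrad F x; have a0 : a != 0 := F0 x Ux.
have aa : 0 < dot a a by rewrite dot_gt0.
have decr v : dot a v < 0 -> dot y v <= 0.
  rewrite egradE// => av.
  have [t /andP[t0 _] [/(_ t0) Flt Ut]] := near0_gt0_and (diff_lt0_near dF av)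
    (near_line v (open_nbhs_nbhs (conj oU Ux))).
  have /xmax : K (x + t *: v).
    by apply/(KF _ Ut)/ltW/(lt_le_trans Flt)/(KF x Ux).
  by rewrite dotDr dotZr gerDl pmulr_rle0.
have yE : y = (dot y a / dot a a) *: a.
  apply: dot_parallel => v av.
  (* [w - s a] is a direction of strict decrease close to [w]. *)
  have le0 w : dot a w = 0 -> dot y w <= 0.
    move=> aw; apply/ler_addgt0Pr => e e0; rewrite add0r.
    pose s := e / (`|dot y a| + 1).
    have s0 : 0 < s by rewrite divr_gt0// ltr_pwDr.
    have : dot y (w - s *: a) <= 0.
      by apply: decr; rewrite dotBr aw dotZr sub0r oppr_lt0 mulr_gt0.
    rewrite dotBr dotZr subr_le0 => /le_trans; apply.
    rewrite /s mulrAC ler_pdivrMr ?ltr_pwDr// ler_pM2l//.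
    by rewrite (le_trans (ler_norm _))// lerDl.
  apply/eqP; rewrite eq_le le0//= -oppr_le0 -dotNr; apply: le0.
  by rewrite dotNr av oppr0.
set c := _ / _ in yE.
have c0 : 0 < c.
  rewrite lt_neqAle eq_sym; apply/andP; split.
    by apply: contraNneq y0 => c0; rewrite yE c0 scale0r.
  apply: divr_ge0; last exact: ltW.
  by have := decr (- a); rewrite !dotNr oppr_lt0 oppr_le0 => ->.
rewrite /unit_normal -/a yE enormZ ?ltW// invfM scalerA mulrAC.
by rewrite mulVf ?mul1r// gt_eqF.
Qed.

Lemma convex_segment K x v t : convex_set K -> 0 <= t -> t <= 1 ->
  K x -> K (x + v) -> K (x + t *: v).
Proof.
move=> cK t0 t1 Kx Kv.
have := cK (x + v) x (Itv01 t0 t1) (mem_set Kv) (mem_set Kx).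
rewrite inE; congr K; change (t *: (x + v) + (1 - t) *: x = x + t *: v).
rewrite scalerDr scalerBl scale1r.
by rewrite addrC addrA subrK.
Qed.

(** Convexity turns the first order information at a boundary point into a
global one: its normal is an outer normal of the whole body. *)
Lemma bdry_maximizes K U F p : chart K U F -> convex_set K -> U p -> K p ->
  bdry K p -> maximizes K (unit_normal F p) p.
Proof.
move=> ch cK Up Kp bp; have F0 := chart_bdry_eq0 ch Up bp Kp.
move: ch => [oU cF KF Fn0]; split=> // q Kq.
have dF : differentiable F p := (cF 1%N).1 p Up.
rewrite -subr_ge0 -dotBr dotZl mulr_ge0 ?invr_ge0 ?enorm_ge0//.
rewrite egradE// leNgt; apply/negP => Fv.
have Gv : 'd (- F) p (q - p) < 0.
  rewrite diffN//; change (- 'd F p (q - p) < 0).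
  by rewrite -linearN opprB.
have [t /andP[t0 t1] [/(_ t0) Flt Ut]] :=
  near0_gt0_and (diff_lt0_near (differentiableN dF) Gv)
    (near_line (q - p) (open_nbhs_nbhs (conj oU Up))).
have : F (p + t *: (q - p)) <= 0.
  apply/(KF _ Ut); apply: convex_segment => //; try exact: ltW.
  by rewrite addrC subrK.
move: Flt; change (- F (p + t *: (q - p)) < - F p -> F (p + t *: (q - p)) <= 0 -> False).
by rewrite F0 oppr0 oppr_lt0 ltNge => /negP.
Qed.

End SupportPoint.

(** * The support point and the support function *)

Section CurvedBody.
Context {R : realType} {n : nat} (K : set 'rV[R]_n) (hK : smooth_curved_body K).
Local Notation E := 'rV[R]_n.
Implicit Types (p u v x y : E).

Local Notation h := (support_fun K).
Local Notation xK := (support_point K).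

Lemma body_closed : closed K.
Proof. by case: hK => cK _ _ _; apply: compact_closed => //; exact: norm_hausdorff. Qed.

Lemma body_bdry p : bdry K p -> K p.
Proof. by move=> [] /body_closed. Qed.

Lemma bdry_chart p : bdry K p -> exists (U : set E) (F : E -> R),
  [/\ chart K U F, U p & forall v, v != 0 -> dot (egrad F p) v = 0 ->
           0 < dot ('D_v (unit_normal F) p) v].
Proof.
case: hK => _ _ _ ch /ch[U [F [[oU Up] cF KF F0 curv]]].
have cG : Ck 0 U (egrad F) := Ck_egrad oU (cF 1%N).
exists (U `&` egrad F @^-1` [set z | z != 0]), F; split=> //; split.
- exact: (open_preimage_on oU (open_neq0 _) cG).
- by move=> k; apply: Ck_sub (cF k) => q [].
- by move=> q [/KF].
- by move=> q [].
Qed.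

Lemma maximizer_exists y : exists x, maximizes K y x.
Proof.
case: hK => cK _ K0 _.
have [||x /set_mem Kx xmax] := @EVT_max_rV R n (dot y) K _ cK.
- by exists 0; exact: nbhs_singleton K0.
- by apply: continuous_subspaceT; exact: linear_rV_continuous.
- by exists x; split=> // q Kq; apply: xmax; rewrite inE.
Qed.

Lemma support_pointP y : maximizes K y (xK y).
Proof. exact: (xgetPex 0 (maximizer_exists y)). Qed.

(** On a segment of maximizers the unit normal would be constantly [y / |y|],
so its derivative along the segment would vanish, against the curvature being
positive. *)
Lemma maximizer_unique y x1 x2 : y != 0 ->
  maximizes K y x1 -> maximizes K y x2 -> x1 = x2.
Proof.
move=> y0 m1 m2; apply/eqP; rewrite eq_sym -subr_eq0; apply/negP => /negP v0.
set v := x2 - x1 in v0.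
have [_ cK _ _] := hK.
have [U [F [ch Ux curv]]] := bdry_chart (maximizes_bdry y0 m1).
have [oU cF KF F0] := ch.
have nx := maximizes_unit_normal ch Ux y0 m1.
have yv : dot y v = 0.
  by apply/eqP; rewrite dotBr subr_eq0 eq_le m1.2 ?m2.2//; [exact: m1.1 | exact: m2.1].
have av : dot (egrad F x1) v = 0.
  have : dot (unit_normal F x1) v = 0 by rewrite nx dotZl yv mulr0.
  rewrite dotZl => /eqP; rewrite mulf_eq0 invr_eq0 gt_eqF ?enorm_gt0 ?F0//=.
  by move/eqP.
have dN : differentiable (unit_normal F) x1.
  exact: ((Cinfty_unit_normal oU cF F0) 1%N).1.
suff D0 : 'D_v (unit_normal F) x1 = 0 by have := curv v v0 av; rewrite D0 dot0l ltxx.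
rewrite deriveE//; apply/eqP; rewrite -normr_eq0 eq_le normr_ge0 andbT.
apply/ler_addgt0Pr => e e0; rewrite add0r.
have vn : 0 < `|v| by rewrite normr_gt0.
have ev : 0 < e / `|v| by rewrite divr_gt0.
have [t /andP[t0 t1] [dt Ut]] := near0_gt0_and
  (near_line v (diff_near dN ev)) (near_line v (open_nbhs_nbhs (conj oU Ux))).
have mt : maximizes K y (x1 + t *: v).
  split; last by move=> q /m1.2; rewrite dotDr dotZr yv mulr0 addr0.
  apply: convex_segment => //; [exact: ltW | exact: ltW | exact: m1.1 |].
  by rewrite addrC subrK; exact: m2.1.
move: dt => /=; rewrite (maximizes_unit_normal ch Ut y0 mt) nx subrr sub0r normrN.
rewrite [x1 + _ - x1]addrAC subrr add0r linearZ !normrZ (gtr0_norm t0).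
by rewrite mulrCA divfK ?gt_eqF// ler_pM2l.
Qed.

Lemma maximizes_support_point y x : y != 0 -> maximizes K y x -> xK y = x.
Proof. by move=> y0 mx; exact: maximizer_unique y0 (support_pointP y) mx. Qed.

Lemma support_pointZ (t : R) y : 0 < t -> y != 0 -> xK (t *: y) = xK y.
Proof.
move=> t0 y0; have [Kx xm] := support_pointP y.
apply: maximizes_support_point; first by rewrite scaler_eq0 negb_or gt_eqF.
by split=> // q /xm; rewrite !dotZl ler_pM2l.
Qed.

Lemma support_point_bdry y : y != 0 -> bdry K (xK y).
Proof. by move=> y0; exact: maximizes_bdry (support_pointP y). Qed.

Lemma support_point_inj y1 y2 : usphere y1 -> usphere y2 -> xK y1 = xK y2 -> y1 = y2.
Proof.
move=> s1 s2 x12; have y10 := usphere_neq0 s1; have y20 := usphere_neq0 s2.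
have [U [F [ch Ux _]]] := bdry_chart (support_point_bdry y10).
have := maximizes_unit_normal ch Ux y10 (support_pointP y1).
rewrite x12 in Ux *; rewrite (maximizes_unit_normal ch Ux y20 (support_pointP y2)).
by rewrite s1 s2 invr1 !scale1r.
Qed.

Lemma support_point_surj p : bdry K p -> exists2 y, usphere y & xK y = p.
Proof.
move=> bp; have [_ cK _ _] := hK; have [U [F [ch Up _]]] := bdry_chart bp.
have [oU cF KF F0] := ch.
exists (unit_normal F p); first by apply: usphere_normalize; exact: F0.
apply: maximizes_support_point.
  by apply: usphere_neq0; apply: usphere_normalize; exact: F0.
exact: bdry_maximizes ch cK Up (body_bdry bp) bp.
Qed.

Lemma dot_bounded_on_body :
  exists2 M : R, 0 < M & forall u q, K q -> `|dot u q| <= M * `|u|.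
Proof.
have [cK _ _ _] := hK.
have [N [Nr NK]] := compact_bounded cK.
pose B := `|N| + 1; have BK q : K q -> `|q| <= B.
  by move=> Kq; apply: (NK B) => //; rewrite ltr_pwDr// ler_norm.
have B0 : 0 < B by rewrite ltr_pwDr.
exists (n%:R * B + 1) => [|u q /BK qB].
  by rewrite ltr_pwDr// mulr_ge0// ltW.
apply: le_trans (ler_norm_dot _ _) _.
rewrite mulrDl mul1r ler_wpDr// -mulrA ler_wpM2l// mulrC.
by rewrite ler_wpM2r.
Qed.

(** The part of the body away from the maximizer of [<y0, .>] is compact, so
its values stay below the maximum by a fixed gap, which small changes of [y0]
cannot bridge. *)
Lemma support_point_continuous y0 : y0 != 0 -> {for y0, continuous xK}.
Proof.
move=> y00 V nV; have [cK _ _ _] := hK; have [Kx0 xm0] := support_pointP y0.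
have [M M0 MK] := dot_bounded_on_body.
pose C := K `&` ~` V°.
have cC : compact C.
  by apply: compact_closedI => //; apply: open_closedC; exact: open_interior.
have [d d0 gap] : exists2 d, 0 < d & forall q, C q -> dot y0 q <= dot y0 (xK y0) - d.
  have [C0|/set0P C0] := eqVneq C set0.
    by exists 1 => // q; rewrite C0.
  have cd : {within C, continuous (dot y0)}.
    by apply: continuous_subspaceT; exact: linear_rV_continuous.
  have [x /set_mem[Kx nVx] xmax] := EVT_max_rV C0 cC cd.
  exists (dot y0 (xK y0) - dot y0 x).
    rewrite subr_gt0 lt_neqAle xm0// andbT; apply/eqP => xE; apply: nVx.
    have -> : x = xK y0.
      apply/esym/maximizes_support_point => //.
      by split=> // q /xm0; rewrite xE.
    exact: nV.
  by move=> q Cq; rewrite opprB addrC subrK; apply: xmax; rewrite inE.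
have dM : 0 < d / (2 * M) by rewrite divr_gt0// mulr_gt0.
have nb : \forall y \near y0, `|y0 - y| < d / (2 * M).
  by have := nbhsx_ballx y0 _ dM; rewrite -ball_normE.
apply: filterS nb => y yb; suff : V° (xK y) by exact: interior_subset.
apply: contrapT => nVy.
have [Kx xm] := support_pointP y.
have := gap _ (conj Kx nVy); have := xm _ Kx0.
have yb2 : M * `|y - y0| < d / 2.
  rewrite distrC -ltr_pdivlMl//; apply: (lt_le_trans yb).
  by rewrite invfM mulrA mulrC.
have := MK (y - y0) _ Kx0; have := MK (y - y0) _ Kx.
rewrite !dotBl !ler_norml => /andP[_ a1] /andP[a2 _].
lra.
Qed.

Lemma support_funE y : h y = dot y (xK y).
Proof.
have [Kx xm] := support_pointP y; apply/eqP; rewrite eq_le; apply/andP; split.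
  apply: ge_sup; first by exists (dot y (xK y)), (xK y).
  by move=> _ [q Kq <-]; exact: xm.
apply: ub_le_sup; last by exists (xK y).
by exists (dot y (xK y)) => _ [q Kq <-]; exact: xm.
Qed.

Lemma support_fun_gt0 y : y != 0 -> 0 < h y.
Proof.
move=> y0; have [_ _ K0 _] := hK; have [_ xm] := support_pointP y.
have [t /andP[t0 _]] := near0_gt0 (near_line y K0).
rewrite add0r => /xm; rewrite -support_funE dotZr => /(lt_le_trans _); apply.
by rewrite mulr_gt0// dot_gt0.
Qed.

Lemma support_fun0 : h 0 = 0.
Proof. by rewrite support_funE dot0l. Qed.

Lemma support_funZ (t : R) y : 0 < t -> h (t *: y) = t * h y.
Proof.
move=> t0; have [->|y0] := eqVneq y 0; first by rewrite scaler0 support_fun0 mulr0.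
by rewrite !support_funE support_pointZ// dotZl.
Qed.

(** Comparing the maximizers at two nearby points sandwiches the increment of
[h] between [<y - y0, x(y0)>] and [<y - y0, x(y)>]. *)
Lemma is_diff_support_fun y0 : y0 != 0 -> is_diff y0 h (dot (xK y0)).
Proof.
move=> y00; apply: near_diff; first exact: linear_rV_continuous.
move=> e e0; have n1 : 0 < n%:R + 1 :> R by rewrite ltr_pwDr.
have en : 0 < e / (n%:R + 1) by rewrite divr_gt0.
have cx : xK y @[y --> y0] --> xK y0 := support_point_continuous y00.
have nx : \forall y \near y0, `|xK y0 - xK y| <= e / (n%:R + 1).
  by move/cvgrPdist_le : cx => /(_ _ en).
apply: filterS nx => y xy.
have [Kx xm] := support_pointP y; have [Kx0 xm0] := support_pointP y0.
have -> : h y - h y0 - dot (xK y0) (y - y0) = dot y (xK y - xK y0).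
  by rewrite !support_funE !dotBr !(dotC (xK y0)); ring.
have lo : 0 <= dot y (xK y - xK y0) by rewrite dotBr subr_ge0 xm.
have hi : dot y (xK y - xK y0) <= dot (y - y0) (xK y - xK y0).
  by rewrite dotBl lerDl oppr_ge0 dotBr subr_le0 xm0.
rewrite ger0_norm// (le_trans hi)// (le_trans (ler_norm _))//.
apply: le_trans (ler_norm_dot _ _) _; rewrite (distrC (xK y)).
rewrite mulrCA mulrC ler_wpM2r//.
apply: (@le_trans _ _ (n%:R * (e / (n%:R + 1)))); first by rewrite ler_wpM2l.
have n2 : n%:R / (n%:R + 1) <= 1 :> R by rewrite ler_pdivrMr// mul1r lerDl.
by rewrite mulrCA ler_piMr// ltW.
Qed.

Lemma egrad_support_fun y : y != 0 -> egrad h y = xK y.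
Proof.
move=> y0; have [dh dhE] := is_diff_support_fun y0.
by apply: dot_inj => v; rewrite egradE// dhE.
Qed.

Lemma derive_support_fun y v : y != 0 -> 'D_v h y = dot (xK y) v.
Proof.
by move=> y0; have [dh dhE] := is_diff_support_fun y0; rewrite deriveE// dhE.
Qed.

End CurvedBody.

(** * Smoothness of the support point *)

Section Normalization.
Context {R : realType} {n : nat}.
Local Notation E := 'rV[R]_n.

Lemma Cinfty_normalize : Cinfty [set y : E | y != 0] (@normalize R n).
Proof. by move=> k; apply: Ck_normalized => //; [exact: open_neq0 | exact: Ck_id]. Qed.

Lemma derive_normalize (y v : E) : y != 0 ->
  is_derive y v (@normalize R n) ((enorm y)^-1 *: (v - (dot y v / dot y y) *: y)).
Proof.
move=> y0; have yn : enorm y != 0 by rewrite gt_eqF ?enorm_gt0.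
have de := is_derive_enorm v y0.
have dei : is_derive y v (fun q : E => (enorm q)^-1)
    (- (enorm y ^+ 2)^-1 * ((enorm y)^-1 * dot y v)).
  have [dn dnE] := de; split; first exact: derivableV.
  by rewrite deriveV// dnE.
apply: (is_derive_eq (is_derive_scaler dei (is_derive_id y v))).
rewrite -sqr_enorm addrC scalerBr scalerA -scaleNr; congr (_ + _ *: _).
by rewrite mulNr mulrCA [dot y v / _]mulrC.
Qed.

End Normalization.

Section SupportSmooth.
Context {R : realType} {n : nat} (K : set 'rV[R]_n) (hK : smooth_curved_body K).
Local Notation E := 'rV[R]_n.
Implicit Types (p u v x y : E).

Local Notation h := (support_fun K).
Local Notation xK := (support_point K).

Lemma unit_normal_support_point (U : set E) F y : chart K U F -> U (xK y) -> y != 0 ->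
  unit_normal F (xK y) = normalize y.
Proof. by move=> ch Uy y0; exact: maximizes_unit_normal ch Uy y0 (support_pointP hK y). Qed.

(** The unit normal extended off the boundary as [(1 + F) nu_F] is a local
diffeomorphism of [E], because the differential of [nu_F] is injective on the
tangent space and [F] accounts for the normal direction.  The support point is
a right inverse of it up to normalization. *)
Lemma Cinfty_support_point : Cinfty [set y : E | y != 0] xK.
Proof.
move=> k; apply: Ck_local => y0 /= y00.
have bp := support_point_bdry hK y00; set p := xK y0 in bp.
have [U [F [ch Up curv]]] := bdry_chart hK bp.
have [oU cF KF F0] := ch; have cN := Cinfty_unit_normal oU cF F0.
pose f q := (1 + F q) *: unit_normal F q.
have cf : Cinfty U f.
  move=> m; apply: (Ck_scaler oU _ (cN m)).
  by apply: (CkD oU _ (cF m)); exact: Ck_cst.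
have df q : U q -> differentiable f q := (cf 1%N).1 q.
have Fp0 : F p = 0 := chart_bdry_eq0 ch Up bp (body_bdry hK bp).
have dF := (cF 1%N).1 p Up; have dN := (cN 1%N).1 p Up.
have Nn : usphere (unit_normal F p) by apply: usphere_normalize; exact: F0.
have finj v : 'd f p v = 0 -> v = 0.
  have -> : 'd f p v = 'd F p v *: unit_normal F p + 'd (unit_normal F) p v.
    apply: diff_val_derive; first exact: df.
    have d1F : is_derive p v (fun q => 1 + F q) ('d F p v).
      rewrite -['d F p v]add0r.
      exact: (is_deriveD (is_derive_cst (1 : R) p v) (is_derive_diff v dF)).
    apply: (is_derive_eq (is_derive_scaler d1F (is_derive_diff v dN))).
    by rewrite Fp0 addr0 scale1r.
  move=> fv; have Ndn : dot (unit_normal F p) ('d (unit_normal F) p v) = 0.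
    have dd := is_derive_dot (is_derive_diff v dN) (is_derive_diff v dN).
    have ncst : {near p, (fun q => dot (unit_normal F q) (unit_normal F q)) =1 cst (1 : R)}.
      apply: filterS (open_nbhs_nbhs (conj oU Up)) => q /F0 gq.
      by apply/usphereE; exact: usphere_normalize.
    have := is_derive_uniq (near_eq_is_derive ncst dd) (is_derive_cst (1 : R) p v).
    by rewrite [X in X + _]dotC -mulr2n => /eqP; rewrite mulrn_eq0 => /eqP.
  have Fv : 'd F p v = 0.
    have := congr1 (dot (unit_normal F p)) fv.
    by rewrite dotDr dotZr (usphereE _).1// mulr1 Ndn addr0 dot0r.
  apply/eqP; apply: contraTT isT => v0.
  have := curv v v0; rewrite egradE// deriveE// => /(_ Fv).
  by move: fv; rewrite Fv scale0r add0r => ->; rewrite dot0l ltxx.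
pose D q := \det (lin1_mx ('d f q)).
have cD : Ck 0 U D.
  apply: Ck_det => // i j.
  apply: (@Ck_eq _ _ _ _ _ (fun q => 'D_(delta_mx 0 i) f q 0 j)) => //.
    by move=> q Uq; rewrite mxE deriveE//; exact: df.
  have cDf : Ck 0 U ('D_(delta_mx 0 i) f) := (cf 1%N).2 _.
  exact: ((Ck_rVP _ _ oU).1 cDf j).
pose V := U `&` D @^-1` [set z | z != 0].
have oV : open V := open_preimage_on oU (open_neq0 _) cD.
have Vp : V p.
  by split=> //=; have /lin1_mx_unitP := finj; rewrite unitmxE unitfE.
pose W := [set y : E | y != 0] `&` xK @^-1` V.
have oW : open W.
  apply: (open_preimage_on (@open_neq0 R E) oV) => y yn0.
  exact: support_point_continuous.
exists W; split=> //.
suff : Cinfty W xK by apply.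
have WV y : W y -> V (xK y) by case.
have fx y : W y -> f (xK y) = normalize y.
  move=> [/= yn0 [Uy _]]; rewrite /f (unit_normal_support_point ch)//.
  have by_ := support_point_bdry hK yn0.
  by rewrite (chart_bdry_eq0 ch Uy by_ (body_bdry hK by_)) addr0 scale1r.
have cx y : W y -> {for y, continuous xK}.
  by move=> [/= yn0 _]; exact: support_point_continuous.
have cfV : Cinfty V f by move=> m; apply: Ck_sub (cf m) => q [].
have cnW : Cinfty W normalize.
  by move=> m; apply: Ck_sub (Cinfty_normalize m) => q [].
apply: (Cinfty_inverse oW oV WV fx cx cfV cnW) => y v [_ [_ /= Dy]].
by apply: (lin1_mx_unitP _).1; rewrite unitmxE unitfE.
Qed.

Lemma differentiable_support_point y : y != 0 -> differentiable xK y.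
Proof. exact: (Cinfty_support_point 1%N).1. Qed.

Lemma dot_dsupport_point y v : y != 0 -> dot y ('d xK y v) = 0.
Proof.
move=> y0; have dx := is_derive_diff v (differentiable_support_point y0).
have [dh dhE] := is_diff_support_fun hK y0.
have := is_derive_dot (is_derive_id y v) dx.
have <- : h = (fun q => dot q (xK q)) by apply/funext => q; rewrite (support_funE hK).
move=> /is_derive_uniq /(_ (is_derive_diff v dh)); rewrite dhE dotC.
by move/eqP; rewrite eq_sym addrC -subr_eq subrr eq_sym => /eqP.
Qed.

Lemma dsupport_point_sym y u v : y != 0 ->
  dot ('d xK y u) v = dot u ('d xK y v).
Proof.
move=> y0; have nb : \forall q \near y, q != 0.
  exact: open_nbhs_nbhs (conj (open_neq0 _) y0).
have dx := differentiable_support_point y0.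
have dh : \forall q \near y, differentiable h q.
  by apply: filterS nb => q q0; case: (is_diff_support_fun hK q0).
have Dh w : {near y, (fun q => dot (xK q) w) =1 'D_w h}.
  by apply: filterS nb => q q0; rewrite (derive_support_fun hK).
have ddh w : differentiable ('D_w h) y.
  have dxw : differentiable (fun q => dot (xK q) w) y.
    exact: differentiable_dot dx (differentiable_cst w y).
  by case: (near_eq_differentiable (Dh w) dxw).
have DDh w z : 'D_z ('D_w h) y = dot ('d xK y z) w.
  have := is_derive_dot (is_derive_diff z dx) (is_derive_cst w y z).
  by move=> /(near_eq_is_derive (Dh w)) [_ ->]; rewrite dot0r addr0.
by rewrite -DDh (derive_symmetric dh (ddh _) (ddh _)) DDh dotC.
Qed.

(** On the tangent space at the unit vector [y], the differential of the
support point inverts that of the Gauss map, whose quadratic form is the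
curvature. *)
Lemma dsupport_point_gt0 y v : usphere y -> dot y v = 0 -> v != 0 ->
  0 < dot v ('d xK y v).
Proof.
move=> sy yv v0; have y0 := usphere_neq0 sy.
have bp := support_point_bdry hK y0.
have [U [F [ch Up curv]]] := bdry_chart hK bp.
have [oU cF KF F0] := ch.
have dN := (Cinfty_unit_normal oU cF F0 1%N).1 _ Up.
have dx := differentiable_support_point y0.
set w := 'd xK y v.
have Nw : 'd (unit_normal F) (xK y) w = v.
  have Nx : {near y, unit_normal F \o xK =1 normalize}.
    have cx := support_point_continuous hK y0.
    have Uq : \forall q \near y, U (xK q) := cx _ (open_nbhs_nbhs (conj oU Up)).
    apply: filterS2 Uq (open_nbhs_nbhs (conj (open_neq0 _) y0)) => q Uq q0 /=.
    exact: unit_normal_support_point ch Uq q0.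
  have := near_eq_is_derive Nx (is_derive_chain dN (is_derive_diff v dx)).
  move=> /is_derive_uniq /(_ (derive_normalize v y0)) ->.
  by rewrite sy invr1 scale1r yv mul0r scale0r subr0.
have Fw : dot (egrad F (xK y)) w = 0.
  have := dot_dsupport_point v y0; rewrite -/w => yw.
  have : dot (unit_normal F (xK y)) w = 0.
    by rewrite (unit_normal_support_point ch)// dotZl yw mulr0.
  rewrite dotZl => /eqP; rewrite mulf_eq0 invr_eq0 gt_eqF ?enorm_gt0 ?F0//=.
  by move/eqP.
have w0 : w != 0.
  by apply: contra_neq v0 => w0; rewrite -Nw w0 linear0.
by have := curv w w0 Fw; rewrite deriveE// Nw.
Qed.

End SupportSmooth.

(** * Hypersurfaces parametrized by the sphere *)

Section RadialChart.
Context {R : realType} {n : nat}.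
Local Notation E := 'rV[R]_n.
Implicit Types (M : set E) (p u v w theta : E) (sg : E -> E).

Lemma usphere_compact : compact (@usphere R n).
Proof.
apply: bounded_closed_compact.
  exists 1; split=> // B B1 u /usphereE u1 /=; rewrite (le_trans _ (ltW B1))//.
  rewrite /Num.Def.normr/= mx_normrE (bigmax_le _ ler01)//= => -[i j] _ /=.
  rewrite (ord1 i) -(@ler_pXn2r _ 2)// ?nnegrE// real_normK ?num_real// expr1n -u1.
  by rewrite /dot (bigD1 j)//= -expr2 lerDl sumr_ge0// => k _; rewrite -expr2 sqr_ge0.
have -> : @usphere R n = (fun u : E => dot u u) @^-1` [set 1].
  by apply/seteqP; split=> u /usphereE.
apply: closed_comp; last exact/accessible_closed_set1/hausdorff_accessible/norm_hausdorff.
by move=> u _; apply: differentiable_continuous; exact: differentiable_dot.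
Qed.

(** A parametrization of [M] by the unit sphere, extended to be homogeneous of
degree 0.  The last condition says that the differential of the conical extension
[y |-> |y| sg y] is injective along the sphere: [sg] is an immersion of the
sphere, and its image is transversal to the rays from the origin. *)
Definition radial_chart M sg : Prop :=
  [/\ Cinfty [set y : E | y != 0] sg,
      forall (t : R) y, 0 < t -> y != 0 -> sg (t *: y) = sg y,
      set_bij usphere M sg &
      forall theta v, usphere theta ->
        dot theta v *: sg theta + 'd sg theta v = 0 -> v = 0].

Context {M : set E} {sg : E -> E} (hM : radial_chart M sg).

Definition radial_inv p := xget 0 [set y | usphere y /\ sg y = p].

Lemma sg_normalize y : y != 0 -> sg (normalize y) = sg y.
Proof. by case: hM => _ hom _ _ y0; rewrite hom// invr_gt0 enorm_gt0. Qed.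

Lemma sg_in y : y != 0 -> M (sg y).
Proof.
case: hM => _ _ [fun_sg _ _] _ y0; rewrite -sg_normalize//; apply: fun_sg.
by apply: usphere_normalize.
Qed.

Lemma radial_invK p : M p -> usphere (radial_inv p) /\ sg (radial_inv p) = p.
Proof.
case: hM => _ _ [_ _ surj] _ /surj[y sy yp].
by apply: (xgetPex 0 (P := [set y | usphere y /\ sg y = p])); exists y.
Qed.

Lemma sgK theta : usphere theta -> radial_inv (sg theta) = theta.
Proof.
move=> st; have [_ _ [_ inj _] _] := hM.
have [si si2] := radial_invK (sg_in (usphere_neq0 st)).
by apply: inj => //; rewrite inE.
Qed.

Lemma differentiable_sg y : y != 0 -> differentiable sg y.
Proof. by case: hM => /(_ 1%N)[h _] _ _ _; exact: h. Qed.

Lemma dsg_inj theta w1 w2 : usphere theta -> dot theta w1 = 0 -> dot theta w2 = 0 ->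
  'd sg theta w1 = 'd sg theta w2 -> w1 = w2.
Proof.
move=> st t1 t2 e; apply/eqP; rewrite -subr_eq0; apply/eqP.
have [_ _ _ inj] := hM; apply: (inj theta) => //.
by rewrite dotBr t1 t2 subrr scale0r add0r linearB e subrr.
Qed.

(** The inverse of a continuous bijection of a compact space is continuous. *)
Lemma radial_inv_continuous theta (V : set E) : usphere theta -> nbhs theta V ->
  \forall p \near sg theta, M p -> V (radial_inv p).
Proof.
move=> st nV; pose C := @usphere R n `&` ~` V°.
have cC : compact C.
  apply: compact_closedI; first exact: usphere_compact.
  by apply: open_closedC; exact: open_interior.
have cS : compact (sg @` C).
  apply: continuous_compact => //; apply: continuous_in_subspaceT => y /set_mem[sy _].
  by apply: differentiable_continuous; exact: differentiable_sg (usphere_neq0 sy).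
have oS : open (~` (sg @` C)).
  by apply: closed_openC; apply: compact_closed cS; exact: norm_hausdorff.
have nS : (~` (sg @` C)) (sg theta).
  move=> [y [sy nVy] yE]; apply: nVy.
  suff -> : y = theta by [].
  by rewrite -(sgK sy) yE sgK.
apply: filterS (open_nbhs_nbhs (conj oS nS)) => p np Mp.
have [sp pE] := radial_invK Mp.
suff : V° (radial_inv p) by exact: interior_subset.
by apply: contrapT => nVp; apply: np; exists (radial_inv p).
Qed.

(** Curves in [M] are the images under [sg] of the curves in the sphere, and they
are differentiable together: the conical extension of [sg] has an invertible
differential, so the spherical curve inherits its differentiability from its
image. *)
Lemma curve_radial theta u (c : R -> E) : usphere theta ->
  curve_through M (sg theta) u c ->
  exists w, [/\ dot theta w = 0, 'd sg theta w = u,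
    is_derive (0 : R) 1 (radial_inv \o c) w &
    \forall t \near (0 : R), sg (radial_inv (c t)) = c t].
Proof.
move=> st [Mc c0 dc]; have t0 := usphere_neq0 st.
pose g := radial_inv \o c; pose f y := enorm y *: sg y.
have g0 : g 0 = theta by rewrite /g /= c0 sgK.
have cc : {for (0 : R), continuous c}.
  by apply: differentiable_continuous; apply/derivable1_diffP; case: dc.
have sgg : \forall t \near (0 : R), sg (radial_inv (c t)) = c t.
  by apply: filterS Mc => t /radial_invK[].
have fgc : {near (0 : R), f \o g =1 c}.
  by apply: filterS Mc => t /radial_invK[sg1 sgE]; rewrite /f /g /= sg1 scale1r sgE.
have cg : {for (0 : R), continuous g}.
  move=> V; rewrite g0 => nV.
  have nb := radial_inv_continuous st nV; rewrite -c0 in nb.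
  have ncV : \forall t \near (0 : R), M (c t) -> V (radial_inv (c t)) := cc _ nb.
  by apply: filterS2 Mc ncV => t Mct; exact.
have dsg := differentiable_sg t0.
have df : differentiable f (g 0).
  by rewrite g0; exact: differentiable_scaler (differentiable_enorm t0) dsg.
have dfE v : 'd f (g 0) v = dot theta v *: sg theta + 'd sg theta v.
  apply: (diff_val_derive df); rewrite g0.
  apply: (is_derive_eq (is_derive_scaler (is_derive_enorm v t0) (is_derive_diff v dsg))).
  by rewrite st invr1 mul1r scale1r.
have dcc : differentiable c (0 : R) by apply/derivable1_diffP; case: dc.
have dg : differentiable g (0 : R).
  apply: (differentiable_inverse fgc cg df dcc) => v.
  by rewrite dfE; have [_ _ _ inj] := hM; exact: inj.
have fw : 'd f (g 0) ('d g (0 : R) 1) = 'D_1 c 0 := is_derive_inverse (1 : R) fgc df dg.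
move: ('d g (0 : R) 1) (is_derive_diff (1 : R) dg) fw => w gw fw.
have tw : dot theta w = 0.
  have gg1 : {near (0 : R), (fun t => dot (g t) (g t)) =1 cst (1 : R)}.
    by apply: filterS Mc => t /radial_invK[/usphereE].
  have := is_derive_uniq (near_eq_is_derive gg1 (is_derive_dot gw gw))
    (is_derive_cst (1 : R) (0 : R) (1 : R)).
  by rewrite g0 dotC -mulr2n => /eqP; rewrite mulrn_eq0 => /eqP.
exists w; split; [exact: tw| |exact: gw|exact: sgg].
have fw2 := etrans (esym (dfE w)) fw.
rewrite tw scale0r add0r in fw2.
by rewrite fw2; case: dc.
Qed.

Lemma radial_curve theta w : usphere theta -> dot theta w = 0 ->
  curve_through M (sg theta) ('d sg theta w) (fun t : R => sg (theta + t *: w)).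
Proof.
move=> st tw; have t0 := usphere_neq0 st; split.
- apply: filterS (near_line w (open_nbhs_nbhs (conj (@open_neq0 R E) t0))) => t.
  exact: sg_in.
- by rewrite scale0r addr0.
- have dsg : differentiable sg (theta + (0 : R) *: w).
    by rewrite scale0r addr0; exact: differentiable_sg.
  have := is_derive_chain (g := fun t : R => theta + t *: w) dsg (is_derive_affine theta w 0).
  by rewrite scale0r addr0.
Qed.

Definition orthogonal_space theta : {vspace E} :=
  lker (linfun (dot theta : E -> R^o)).

Lemma orthogonal_spaceP theta u : u \in orthogonal_space theta <-> dot theta u = 0.
Proof. by rewrite memv_ker lfunE; split=> /eqP. Qed.

Lemma tangent_radial theta u : usphere theta ->
  u \in tangent M (sg theta) <-> exists2 w, dot theta w = 0 & u = 'd sg theta w.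
Proof.
move=> st; pose T : {vspace E} := (linfun ('d sg theta) @: orthogonal_space theta)%VS.
have TP v : v \in T <-> exists2 w, dot theta w = 0 & v = 'd sg theta w.
  split=> [/memv_imgP[w /orthogonal_spaceP tw ->]|[w /orthogonal_spaceP tw ->]].
    by exists w => //; rewrite lfunE.
  by apply/memv_imgP; exists w => //; rewrite lfunE.
have TC v : v \in T <-> exists c, curve_through M (sg theta) v c.
  rewrite TP; split=> [[w tw ->]|[c /(curve_radial st)[w [tw <- _ _]]]].
    by exists (fun t : R => sg (theta + t *: w)); exact: radial_curve.
  by exists w.
suff -> : tangent M (sg theta) = T by [].
apply: xget_unique => // T' T'C; apply/vspaceP => v.
by apply/idP/idP => [/T'C/TC|/TC/T'C].
Qed.

(** Derivatives on [M] are derivatives on the sphere of the function read in the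
parametrization.  The latter may be replaced by any function [G] that agrees
with it near [theta], which is where explicit formulas come in. *)
Lemma mderiv_radial (W : normedModType R) (F G : E -> W) theta w d :
  usphere theta -> dot theta w = 0 -> differentiable G theta ->
  {near theta, G =1 F \o sg} -> is_derive theta w G d ->
  mderiv M F (sg theta) ('d sg theta w) = d.
Proof.
move=> st tw dG GF dd.
have [dF _] := near_eq_differentiable GF dG.
have {}dd : 'd (F \o sg) theta w = d.
  exact: diff_val_derive dF (near_eq_is_derive GF dd).
apply: xget_unique => [c cc|d' dP].
  have [w' [tw' w'E dg sgc]] := curve_radial st cc.
  have ww : w' = w by exact: (dsg_inj st tw' tw w'E).
  rewrite ww in dg.
  have [_ c0 _] := cc.
  have g0 : (radial_inv \o c) 0 = theta by rewrite /= c0 sgK.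
  have dF0 : differentiable (F \o sg) ((radial_inv \o c) 0) by rewrite g0.
  have := is_derive_chain dF0 dg; rewrite g0 dd; apply: near_eq_is_derive.
  by apply: filterS sgc => t /= ->.
have dc := dP _ (radial_curve st tw).
apply: (is_derive_uniq dc).
have dF0 : differentiable (F \o sg) (theta + (0 : R) *: w) by rewrite scale0r addr0.
have := is_derive_chain (g := fun t : R => theta + t *: w) dF0 (is_derive_affine theta w 0).
by rewrite scale0r addr0 dd.
Qed.

End RadialChart.

(** * Centro-affine metric and conormal *)

Section CentroAffineStructure.
Context {R : realType} {n : nat} (K : set 'rV[R]_n) (hK : smooth_curved_body K).
Context {M : domain} {sg : 'rV[R]_n -> 'rV[R]_n}.
Context (hM : radial_chart (carrier K M) sg).
Context (param_sg : forall theta, usphere theta ->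
  param K M (sg theta) = support_point K theta).
Local Notation E := 'rV[R]_n.
Implicit Types (p u v w theta y : E) (f : E -> R).

Local Notation h := (support_fun K).
Local Notation xK := (support_point K).

Lemma near_neq0 y : y != 0 -> \forall q \near y, q != 0.
Proof. by move=> y0; exact: (open_nbhs_nbhs (conj (@open_neq0 R E) y0)). Qed.

Lemma support_point_normalize y : y != 0 -> xK (normalize y) = xK y.
Proof. by move=> y0; rewrite support_pointZ// invr_gt0 enorm_gt0. Qed.

(** Adding the projection to the normal line makes the differential of the support
point an automorphism of [E], whose inverse preserves the tangent space. *)
Lemma dsupport_point_inverse theta : usphere theta ->
  exists G : {linear E -> E},
    (forall v, dot theta v = 0 -> dot theta (G v) = 0 /\ 'd xK theta (G v) = v) /\
    (forall w, dot theta w = 0 -> G ('d xK theta w) = w).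
Proof.
move=> st; have t0 := usphere_neq0 st.
pose S v := 'd xK theta v + dot theta v *: theta.
have linS : linear S.
  by move=> a u v; rewrite /S linearP dotDr dotZr scalerDl scalerDr scalerA addrACA.
pose SM := GRing.isLinear.Build _ _ _ _ S linS.
pose SL : {linear E -> E} := HB.pack S SM.
have tS v : dot theta (S v) = dot theta v.
  by rewrite dotDr (dot_dsupport_point hK)// add0r dotZr (usphereE theta).1// mulr1.
have S0 v : SL v = 0 -> v = 0.
  move=> Sv; have tv : dot theta v = 0 by rewrite -tS [S v]Sv dot0r.
  apply/eqP; apply: contraT => v0; have := dsupport_point_gt0 hK st tv v0.
  have -> : 'd xK theta v = S v by rewrite /S tv scale0r addr0.
  by rewrite [S v]Sv dot0r ltxx.
have [G [GS SG]] := linear_rV_inverse S0.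
exists G; split=> [v tv|w tw].
  have SGv : S (G v) = v := SG v.
  have tG : dot theta (G v) = 0 by rewrite -tS SGv.
  by split=> //; rewrite -[RHS]SGv /S tG scale0r addr0.
by have := GS w; rewrite /= /S tw scale0r addr0.
Qed.

Lemma dparam_radial theta w : usphere theta -> dot theta w = 0 ->
  dparam K M (sg theta) ('d sg theta w) = 'd xK theta w.
Proof.
move=> st tw; have t0 := usphere_neq0 st.
have nE : {near theta, xK =1 param K M \o sg}.
  apply: filterS (near_neq0 t0) => y y0 /=.
  rewrite -(sg_normalize hM y0) param_sg; last exact: usphere_normalize.
  by rewrite support_point_normalize.
have dx := differentiable_support_point hK t0.
exact: (mderiv_radial hM st tw dx nE (is_derive_diff w dx)).
Qed.

Lemma tspace_radial theta u : usphere theta ->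
  u \in tspace K M (sg theta) <-> exists2 w, dot theta w = 0 & u = 'd sg theta w.
Proof. exact: tangent_radial. Qed.

(** The images of the tangent vectors fill the hyperplane orthogonal to
[theta], so a covector that kills them is proportional to [theta]. *)
Lemma conormal_radial y : y != 0 -> conormal K M (sg y) = (h y)^-1 *: y.
Proof.
have unit_case theta : usphere theta -> conormal K M (sg theta) = (h theta)^-1 *: theta.
  move=> st; have t0 := usphere_neq0 st; have h0 := support_fun_gt0 hK t0.
  have [G [GP _]] := dsupport_point_inverse st.
  apply: xget_unique => /= [|z].
    rewrite param_sg// dotZl -support_funE// mulVf ?gt_eqF//; split=> // u.
    move=> /(tspace_radial _ st)[w tw ->]; rewrite dparam_radial//.
    by rewrite dotZl dot_dsupport_point// mulr0.
  rewrite param_sg// => -[zx zd].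
  have zE : z = (dot z theta / dot theta theta) *: theta.
    apply: dot_parallel => v tv; have [tG Gv] := GP v tv.
    rewrite -Gv -dparam_radial//; apply: zd; apply/(tspace_radial _ st).
    by exists (G v).
  set c := _ / _ in zE; move: zx; rewrite zE dotZl -(support_funE hK) => ch.
  by congr (_ *: _); rewrite -[LHS](mulfK (x := h theta)) ?gt_eqF// ch mul1r.
move=> y0; rewrite -(sg_normalize hM y0) unit_case; last exact: usphere_normalize.
have e0 : 0 < (enorm y)^-1 by rewrite invr_gt0 enorm_gt0.
rewrite (support_funZ hK y e0) scalerA invfM invrK mulrAC.
by rewrite mulfV ?mul1r// gt_eqF// enorm_gt0.
Qed.

Lemma ca_metric_radial theta u v : usphere theta ->
  dot theta u = 0 -> dot theta v = 0 ->
  ca_metric K M (sg theta) ('d sg theta u) ('d sg theta v) =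
    dot u ('d xK theta v) / h theta.
Proof.
move=> st tu tv; have t0 := usphere_neq0 st; have h0 := support_fun_gt0 hK t0.
have nE : {near theta, (fun y => (h y)^-1 *: y) =1 conormal K M \o sg}.
  by apply: filterS (near_neq0 t0) => y y0 /=; rewrite conormal_radial.
have [dh dhE] := is_diff_support_fun hK t0.
have dhi : differentiable (fun y => (h y)^-1) theta.
  by apply: differentiableV => //; rewrite gt_eqF.
have dc : differentiable (fun y => (h y)^-1 *: y) theta.
  exact: differentiable_scaler.
have dE := is_derive_scaler (is_derive_diff u dhi) (is_derive_id theta u).
rewrite /ca_metric dparam_radial// (mderiv_radial hM st tu dc nE dE).
by rewrite dotDl dotZl dot_dsupport_point// mulr0 add0r dotZl mulrC.
Qed.

End CentroAffineStructure.

(** * Gradient and connection *)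

Section GradientConnection.
Context {R : realType} {n : nat} (K : set 'rV[R]_n) (hK : smooth_curved_body K).
Context {M : domain} {sg : 'rV[R]_n -> 'rV[R]_n}.
Context (hM : radial_chart (carrier K M) sg).
Context (param_sg : forall theta, usphere theta ->
  param K M (sg theta) = support_point K theta).
Context {f : 'rV[R]_n -> R} (hf : Ck_on 2 (carrier K M) f).
Local Notation E := 'rV[R]_n.
Implicit Types (p u v w theta y : E).

Local Notation h := (support_fun K).
Local Notation xK := (support_point K).
Local Notation F := (f \o sg).

Lemma Ck_radial_pullback : Ck 2 [set y : E | y != 0] F.
Proof.
have o0 := @open_neq0 R E; have [csg _ _ _] := hM.
apply: Ck_local => y0 y00.
have [U [G [oU Up cG GF]]] := hf (sg_in hM y00).
pose W := [set y : E | y != 0] `&` sg @^-1` U.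
have oW : open W := open_preimage_on o0 oU (csg 0%N).
exists W; split; first by split.
have WU y : W y -> U (sg y) by case.
have csgW : Ck 2 W sg by apply: Ck_sub (csg 2%N) => y [].
apply: (Ck_eq oW _ (Ck_comp oW oU WU cG csgW)) => y [yn0 Uy].
by apply: GF => //; exact: (sg_in hM yn0).
Qed.

Lemma pullbackZ (t : R) y : 0 < t -> y != 0 -> F (t *: y) = F y.
Proof. by move=> t0 y0 /=; have [_ hom _ _] := hM; rewrite hom. Qed.

Lemma differentiable_pullback y : y != 0 -> differentiable F y.
Proof. exact: Ck_radial_pullback.1. Qed.

Lemma egrad_pullbackZ (t : R) y : 0 < t -> y != 0 ->
  egrad F (t *: y) = t^-1 *: egrad F y.
Proof.
move=> t0 y0; have ty0 : t *: y != 0 by rewrite scaler_eq0 negb_or gt_eqF.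
have dF := differentiable_pullback y0; have dFt := differentiable_pullback ty0.
apply: dot_inj => v; rewrite dotZl.
have dsc : is_derive y v (fun q : E => t *: q) (t *: v).
  have := is_derive_scaler (is_derive_cst t y v) (is_derive_id y v).
  by rewrite scale0r add0r.
have nE : {near y, F \o (fun q : E => t *: q) =1 F}.
  by apply: filterS (near_neq0 y0) => q q0; rewrite /= -[RHS](pullbackZ t0 q0).
have e := is_derive_uniq (near_eq_is_derive nE (is_derive_chain dFt dsc))
  (is_derive_diff v dF).
have := etrans (egradE (t *: v) dFt) (etrans e (esym (egradE v dF))).
by rewrite dotZr => <-; rewrite mulKf ?gt_eqF.
Qed.

Lemma euler_pullback y : y != 0 -> dot (egrad F y) y = 0.
Proof.
move=> y0; have dF := differentiable_pullback y0; rewrite egradE//.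
have /is_derive_line dl := is_derive_diff y dF.
have nE : {near (0 : R), (fun t : R => F (t *: y + y)) =1 cst (F y)}.
  have np : \forall t \near (0 : R), -1 < t by apply: lt_nbhsr; rewrite ltrN10.
  apply: filterS np => t t1; rewrite -[X in _ + X]scale1r -scalerDl.
  by rewrite pullbackZ// addrC -ltrBlDl sub0r.
exact: is_derive_uniq (near_eq_is_derive nE dl) (is_derive_cst _ _ _).
Qed.

(** The image [dx(grad f)] of the centro-affine gradient in [E]: the equation
[<dx(grad f), v> = h dF(v)] for tangent [v] leaves no other tangent vector. *)
Definition ambient_grad y : E := h y *: egrad F y.

Lemma ca_grad_radial theta : usphere theta -> exists w, [/\ dot theta w = 0,
  'd xK theta w = ambient_grad theta & ca_grad K M f (sg theta) = 'd sg theta w].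
Proof.
move=> st; have t0 := usphere_neq0 st; have h0 := support_fun_gt0 hK t0.
have [G [GP _]] := dsupport_point_inverse hK st.
have dF := differentiable_pullback t0.
have [tw Sw] : dot theta (G (ambient_grad theta)) = 0 /\
    'd xK theta (G (ambient_grad theta)) = ambient_grad theta.
  by apply: GP; rewrite dotZr dotC euler_pullback// mulr0.
move: (G (ambient_grad theta)) tw Sw => w tw Sw; exists w; split; [exact: tw|exact: Sw|].
have metric v : dot theta v = 0 -> dot w ('d xK theta v) / h theta = dot (egrad F theta) v.
  move=> tv; rewrite -(dsupport_point_sym hK)// Sw /ambient_grad dotZl mulrC mulKf//.
  by rewrite gt_eqF.
have dfE v : dot theta v = 0 ->
    mderiv (carrier K M) f (sg theta) ('d sg theta v) = dot (egrad F theta) v.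
  move=> tv; rewrite egradE//.
  apply: (mderiv_radial hM st tv dF _ (is_derive_diff v dF)).
  by apply: filterS (near_neq0 t0).
apply: xget_unique => /= [|w' [/(tspace_radial hM _ st)[z tz ->] zP]].
  split; first by apply/(tspace_radial hM _ st); exists w.
  move=> v /(tspace_radial hM _ st)[z tz ->].
  by rewrite (ca_metric_radial hK hM param_sg)// metric// dfE.
suff -> : z = w by [].
apply/eqP; rewrite -subr_eq0; apply: contraT => zw.
have tzw : dot theta (z - w) = 0 by rewrite dotBr tz tw subrr.
have tsp : 'd sg theta (z - w) \in tspace K M (sg theta).
  by apply/(tspace_radial hM _ st); exists (z - w).
have := zP _ tsp; rewrite (ca_metric_radial hK hM param_sg)// dfE// -metric//.
move=> /(divIf (negbT (gt_eqF h0))) /eqP; rewrite -subr_eq0 -dotBl => /eqP e.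
by have := dsupport_point_gt0 hK st tzw zw; rewrite e ltxx.
Qed.

Lemma dparam_ca_grad y : y != 0 ->
  dparam K M (sg y) (ca_grad K M f (sg y)) = ambient_grad y.
Proof.
move=> y0; have st := usphere_normalize y0; rewrite -/(normalize y) in st.
have e0 : 0 < (enorm y)^-1 by rewrite invr_gt0 enorm_gt0.
rewrite -(sg_normalize hM y0); have [w [tw Sw ->]] := ca_grad_radial st.
rewrite (dparam_radial hK hM param_sg)// Sw /ambient_grad /normalize.
rewrite (support_funZ hK _ e0) egrad_pullbackZ// scalerA invrK mulrAC mulVf ?mul1r//.
by rewrite gt_eqF// enorm_gt0.
Qed.

Lemma differentiable_ambient_grad y : y != 0 -> differentiable ambient_grad y.
Proof.
move=> y0; have [dh _] := is_diff_support_fun hK y0.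
apply: differentiable_scaler => //.
exact: (Ck_egrad (@open_neq0 R E) Ck_radial_pullback).1.
Qed.

(** Differentiate [<y, h grad F> = 0], which holds by Euler's relation, and use
[<theta, x> = h]. *)
Lemma ambient_grad_tangent theta u : usphere theta ->
  dot theta ('d ambient_grad theta u + dot (egrad F theta) u *: xK theta) = 0.
Proof.
move=> st; have t0 := usphere_neq0 st.
have da := is_derive_diff u (differentiable_ambient_grad t0).
have nE : {near theta, (fun y => dot y (ambient_grad y)) =1 cst (0 : R)}.
  apply: filterS (near_neq0 t0) => y y0.
  by rewrite /ambient_grad dotZr dotC euler_pullback// mulr0.
have := is_derive_uniq (near_eq_is_derive nE (is_derive_dot (is_derive_id theta u) da))
  (is_derive_cst (0 : R) theta u).
rewrite dotDr dotZr -(support_funE hK) {1}/ambient_grad dotZr (dotC u) mulrC => <-.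
by rewrite addrC.
Qed.

(** This is the Gauss equation for the field [grad f], whose image in [E] is
[h grad F] and for which [g(u, grad f) = dF(u)]. *)
Lemma ca_connection_radial theta u : usphere theta -> dot theta u = 0 ->
  forall z, dot theta z = 0 ->
  'd xK theta z = 'd ambient_grad theta u + dot (egrad F theta) u *: xK theta ->
  ca_connection K M ('d sg theta u) (ca_grad K M f) (sg theta) = 'd sg theta z.
Proof.
move=> st tu z tz zE; have t0 := usphere_neq0 st; have h0 := support_fun_gt0 hK t0.
have nE : {near theta, ambient_grad =1
    (fun q => dparam K M q (ca_grad K M f q)) \o sg}.
  by apply: filterS (near_neq0 t0) => y y0 /=; rewrite dparam_ca_grad.
have da := differentiable_ambient_grad t0.
have metric : ca_metric K M (sg theta) ('d sg theta u) (ca_grad K M f (sg theta)) =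
    dot (egrad F theta) u.
  have [w [tw Sw ->]] := ca_grad_radial st.
  rewrite (ca_metric_radial hK hM param_sg)// Sw /ambient_grad dotZr mulrC mulKf ?gt_eqF//.
  exact: dotC.
have [G [_ GS]] := dsupport_point_inverse hK st.
have field := mderiv_radial hM st tu da nE (is_derive_diff u da).
apply: xget_unique => /= [|w' [/(tspace_radial hM _ st)[z' tz' ->]]].
  split; first by apply/(tspace_radial hM _ st); exists z.
  rewrite field (dparam_radial hK hM param_sg)// metric param_sg//.
  by apply: (canRL (addrK _)); exact: esym zE.
rewrite field (dparam_radial hK hM param_sg)// metric param_sg//.
move=> e; have zz := etrans zE (canLR (subrK _) e).
suff -> : z' = z by [].
exact: etrans (esym (GS z' tz')) (etrans (congr1 G (esym zz)) (GS z tz)).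
Qed.

End GradientConnection.

(** * Traces and the Laplacian *)

Section Trace.
Context {F : fieldType} {vT : vectType F}.

(** Invariance of the trace under the isomorphism [L] and under a change of basis:
the matrices [a] and [b] that exchange the basis of [V], pulled back by [L], and
the basis of [V'] are inverse to each other. *)
Lemma trace_conjugate (V V' : {vspace vT}) (L B : {linear vT -> vT}) (A : vT -> vT) :
  (forall u, u \in V <-> exists2 w, w \in V' & u = L w) ->
  (forall w, w \in V' -> L w = 0 -> w = 0) ->
  (forall w, w \in V' -> B w \in V') ->
  (forall w, w \in V' -> A (L w) = L (B w)) ->
  \sum_i coord (vbasis V) i (A (vbasis V)`_i) =
  \sum_j coord (vbasis V') j (B (vbasis V')`_j).
Proof.
move=> VP L0 BV' AL; set X := vbasis V; set Y := vbasis V'.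
have XV (i : 'I_(\dim V)) : X`_i \in V by apply: vbasis_mem; rewrite mem_nth// size_tuple.
have YV (i : 'I_(\dim V')) : Y`_i \in V' by apply: vbasis_mem; rewrite mem_nth// size_tuple.
have /choice[w wP] : forall i : 'I_(\dim V), exists w, w \in V' /\ X`_i = L w.
  by move=> i; have /VP[w wV wE] := XV i; exists w.
pose b (k : 'I_(\dim V')) (i : 'I_(\dim V)) : F := coord X i (L Y`_k).
pose a (i : 'I_(\dim V)) (j : 'I_(\dim V')) : F := coord Y j (w i).
pose c (j k : 'I_(\dim V')) : F := coord Y k (B Y`_j).
have YE (k : 'I_(\dim V')) : Y`_k = \sum_i b k i *: w i.
  apply/eqP; rewrite -subr_eq0; apply/eqP/L0.
    apply: rpredB; first exact: YV.
    by apply: rpred_sum => i _; apply: rpredZ; exact: (wP i).1.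
  rewrite linearB linear_sum /=; apply/eqP; rewrite subr_eq0; apply/eqP.
  have LYV : L Y`_k \in V by apply/VP; exists Y`_k.
  rewrite [LHS](coord_vbasis LYV); apply: eq_bigr => i _.
  by rewrite linearZ /= -(wP i).2.
have ba (k j : 'I_(\dim V')) : \sum_i b k i * a i j = (k == j)%:R.
  transitivity (coord Y j (\sum_i b k i *: w i)).
    by rewrite linear_sum; apply: eq_bigr => i _; rewrite linearZ.
  by rewrite -YE coord_free ?(basis_free (vbasisP V'))// eq_sym.
transitivity (\sum_i \sum_j \sum_k a i j * (c j k * b k i)).
  apply: eq_bigr => i _; have [wV ->] := wP i.
  rewrite AL// (coord_vbasis wV) !linear_sum; apply: eq_bigr => j _.
  rewrite 3!linearZ /= [X in _ * coord _ _ (L X)](coord_vbasis (BV' _ (YV j))).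
  rewrite !linear_sum mulr_sumr; apply: eq_bigr => k _.
  by rewrite 2!linearZ.
rewrite exchange_big; apply: eq_bigr => j _; rewrite exchange_big /=.
rewrite (bigD1 j)//= [X in _ + X]big1 ?addr0 => [|k kj].
  transitivity (c j j * \sum_i b j i * a i j).
    by rewrite mulr_sumr; apply: eq_bigr => i _; rewrite mulrC mulrA.
  by rewrite ba eqxx mulr1.
transitivity (c j k * \sum_i b k i * a i j).
  by rewrite mulr_sumr; apply: eq_bigr => i _; rewrite mulrC mulrA.
by rewrite ba (negbTE kj) mulr0.
Qed.

End Trace.

Section Sphere.
Context {R : realType} {n : nat}.
Local Notation E := 'rV[R]_n.
Implicit Types (u v theta : E).

Lemma normalize_usphere theta : usphere theta -> normalize theta = theta.
Proof. by move=> st; rewrite /normalize st invr1 scale1r. Qed.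

Lemma radial_chart_normalize : radial_chart (@usphere R n) normalize.
Proof.
split.
- exact: Cinfty_normalize.
- move=> t y t0 y0; rewrite /normalize enormZ ?ltW// scalerA invfM mulrAC.
  by rewrite mulVf ?gt_eqF// mul1r.
- split=> [theta st|theta1 theta2 /set_mem s1 /set_mem s2|theta st].
  + by rewrite /= normalize_usphere.
  + by rewrite !normalize_usphere.
  + by exists theta => //; exact: normalize_usphere.
- move=> theta v st; have t0 := usphere_neq0 st.
  have dn := (Cinfty_normalize 1%N).1 theta t0.
  rewrite (diff_val_derive dn (derive_normalize v t0)) normalize_usphere// st.
  by rewrite invr1 scale1r (usphereE theta).1// divr1 addrC subrK.
Qed.

Lemma tangent_usphere theta : usphere theta ->
  tangent usphere theta = orthogonal_space theta.
Proof.
move=> st; have t0 := usphere_neq0 st.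
have dn := (Cinfty_normalize 1%N).1 theta t0.
have dE w : dot theta w = 0 -> 'd normalize theta w = w.
  move=> tw; rewrite (diff_val_derive dn (derive_normalize w t0)) st tw.
  by rewrite mul0r scale0r subr0 invr1 scale1r.
apply/vspaceP => u; have := tangent_radial radial_chart_normalize u st.
rewrite normalize_usphere// => uP.
apply/idP/idP => [/uP[w tw ->]|/orthogonal_spaceP tu].
  by rewrite dE//; apply/orthogonal_spaceP.
by apply/uP; exists u => //; rewrite dE.
Qed.

Lemma dim_orthogonal_space theta : usphere theta ->
  (\dim (orthogonal_space theta))%:R = n%:R - 1 :> R.
Proof.
move=> st; have := limg_ker_dim (linfun (dot theta : E -> R^o)) fullv.
rewrite capfv dimvf /dim /= mul1n.
have -> : \dim (limg (linfun (dot theta : E -> R^o))) = 1%N.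
  apply/eqP; rewrite eqn_leq; apply/andP; split.
    by have := dimvS (subvf (limg (linfun (dot theta : E -> R^o)))); rewrite dimvf.
  rewrite lt0n dimv_eq0; apply: contraTneq isT => l0.
  have : linfun (dot theta : E -> R^o) theta \in limg (linfun (dot theta : E -> R^o)).
    by rewrite memv_img// memvf.
  by rewrite l0 memv0 lfunE /= (usphereE theta).1// oner_eq0.
by move=> /(congr1 (fun k : nat => k%:R : R)); rewrite natrD => <-; rewrite addrK.
Qed.

End Sphere.

Section LaplacianHBM.
Context {R : realType} {n : nat} (K : set 'rV[R]_n) (hK : smooth_curved_body K).
Context {M : domain} {sg : 'rV[R]_n -> 'rV[R]_n}.
Context (hM : radial_chart (carrier K M) sg).
Context (param_sg : forall theta, usphere theta ->
  param K M (sg theta) = support_point K theta).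
Context {f : 'rV[R]_n -> R} (hf : Ck_on 2 (carrier K M) f).
Local Notation E := 'rV[R]_n.
Implicit Types (p u v w theta y : E).

Local Notation h := (support_fun K).
Local Notation xK := (support_point K).
Local Notation F := (f \o sg).
Local Notation amb := (@ambient_grad R n K sg f).

Lemma ext1_support_fun : ext1 h = h.
Proof.
apply/funext => y; rewrite /ext1; have [->|y0] := eqVneq y 0.
  by rewrite enorm0 mul0r (support_fun0 hK).
have e0 : 0 < enorm y by rewrite enorm_gt0.
by rewrite (support_funZ hK) ?invr_gt0// mulVKf ?gt_eqF.
Qed.

Lemma D2_support_fun theta u v : usphere theta ->
  D2 h theta u v = dot ('d xK theta u) v.
Proof.
move=> st; have t0 := usphere_neq0 st; rewrite /D2 ext1_support_fun.
have nE : {near theta, (fun q => dot (xK q) v) =1 (fun q => 'D_v h q)}.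
  by apply: filterS (near_neq0 t0) => q q0; rewrite (derive_support_fun hK).
have dx := is_derive_diff u (differentiable_support_point hK t0).
have [_ ->] := near_eq_is_derive nE (is_derive_dot dx (is_derive_cst v theta u)).
by rewrite dot0r addr0.
Qed.

(** The 1-homogeneous extension of [f h] is [F h], whose gradient is
[h grad F + F x]. *)
Lemma D2_mul_support_fun (z : E -> R) theta u v :
  (forall y, usphere y -> z y = F y) -> usphere theta ->
  D2 (fun y => z y * h y) theta u v =
  dot ('d amb theta u + dot (egrad F theta) u *: xK theta + F theta *: 'd xK theta u) v.
Proof.
move=> zF st; have t0 := usphere_neq0 st.
have extE q : q != 0 -> ext1 (fun y => z y * h y) q = F q * h q.
  move=> q0; rewrite /ext1 zF; last exact: usphere_normalize.
  have e0 : 0 < (enorm q)^-1 by rewrite invr_gt0 enorm_gt0.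
  rewrite (pullbackZ hM e0 q0) (support_funZ hK _ e0) mulrCA mulVKf//.
  by rewrite gt_eqF// enorm_gt0.
have nE : {near theta, (fun q => dot (amb q + F q *: xK q) v) =1
    (fun q => 'D_v (ext1 (fun y => z y * h y)) q)}.
  apply: filterS (near_neq0 t0) => q q0.
  have nq : {near q, (fun y => F y * h y) =1 ext1 (fun y => z y * h y)}.
    by apply: filterS (near_neq0 q0) => y y0; rewrite extE.
  have dF := differentiable_pullback hM hf q0.
  have [dh dhE] := is_diff_support_fun hK q0.
  have dFd : is_derive q v F (dot (egrad F q) v).
    by rewrite egradE//; exact: is_derive_diff.
  have dhd : is_derive q v h (dot (xK q) v).
    by rewrite -dhE; exact: is_derive_diff.
  have [_ ->] := near_eq_is_derive nq (is_deriveM dFd dhd).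
  by rewrite dotDl /ambient_grad !dotZl addrC.
have da := is_derive_diff u (differentiable_ambient_grad hK hM hf t0).
have dx := is_derive_diff u (differentiable_support_point hK t0).
have dF := differentiable_pullback hM hf t0.
have dFd : is_derive theta u F (dot (egrad F theta) u).
  by rewrite egradE//; exact: is_derive_diff.
have dd := is_derive_dot (is_deriveD da (is_derive_scaler dFd dx)) (is_derive_cst v theta u).
rewrite /D2; have [_ ->] := near_eq_is_derive nE dd.
by rewrite dot0r addr0 addrA.
Qed.

Lemma D2mx_support_fun_sym theta : usphere theta ->
  (D2mx h theta)^T = D2mx h theta.
Proof.
move=> st; apply/matrixP => i j; rewrite !mxE !D2_support_fun//.
by rewrite (dsupport_point_sym hK _ _ (usphere_neq0 st)) dotC.
Qed.

Lemma D2mx_support_fun_unit theta : usphere theta -> D2mx h theta \in unitmx.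
Proof.
move=> st; set Y := vbasis (tangent usphere theta).
rewrite -row_free_unit -kermx_eq0; apply/eqP/row_matrixP => i; rewrite row0.
have : row i (kermx (D2mx h theta)) *m D2mx h theta = 0.
  by rewrite -row_mul mulmx_ker row0.
move: (row i _) => r r0.
pose v := \sum_k r 0 k *: Y`_k.
have vT : v \in tangent usphere theta.
  apply: rpred_sum => k _; apply: rpredZ; apply: vbasis_mem.
  by rewrite mem_nth// size_tuple.
have tv : dot theta v = 0 by move: vT; rewrite tangent_usphere// => /orthogonal_spaceP.
have Svv : dot v ('d xK theta v) = 0.
  have sY (j : 'I_(\dim (tangent (@usphere R n) theta))) : dot Y`_j ('d xK theta v) = 0.
    have := congr1 (fun A : 'M[R]_(1, _) => A 0 j) r0; rewrite !mxE => <-.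
    rewrite (linear_sum ('d xK theta)) (linear_sum (dot Y`_j)).
    apply: eq_bigr => k _; rewrite mxE (D2_support_fun _ _ st).
    by rewrite [X in dot _ X = _]linearZ dotZr dotC.
  transitivity (\sum_k dot ('d xK theta v) (r 0 k *: Y`_k)).
    by rewrite dotC -(linear_sum (dot _)).
  by rewrite big1// => k _; rewrite dotZr dotC sY mulr0.
have v0 : v = 0.
  apply/eqP; apply: contraT => vn0.
  by have := dsupport_point_gt0 hK st tv vn0; rewrite Svv ltxx.
apply/rowP => k; rewrite mxE.
have := congr1 (coord Y k) v0; rewrite linear0 /v coord_sum_free//.
exact: basis_free (vbasisP _).
Qed.

(** On the tangent space of the sphere, [nabla_u grad f] is [S^-1 (S_H u) - F u],
where [S] and [S_H] are the Hessians of [h] and of [H = F h]; the trace of the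
first term is the contraction of [S_H] with [S^-1], because [S] is symmetric. *)
Lemma ca_laplacian_radial (z : E -> R) theta :
  (forall y, usphere y -> z y = F y) -> usphere theta ->
  ca_laplacian K M f (sg theta) = HBM K z theta.
Proof.
move=> zF st; have t0 := usphere_neq0 st.
have [G [GP GS]] := dsupport_point_inverse hK st.
pose D u := 'd amb theta u + dot (egrad F theta) u *: xK theta.
pose B u := G (D u).
have linB : linear B.
  move=> a u v; rewrite /B -linearP; congr (G _).
  by rewrite /D linearP linearP /= scalerDl scalerDr scalerA addrACA.
pose BM := GRing.isLinear.Build _ _ _ _ B linB.
pose BL : {linear E -> E} := HB.pack B BM.
have tD u : dot theta (D u) = 0 := ambient_grad_tangent hK hM hf u st.
have tB u : dot theta (B u) = 0 := (GP _ (tD u)).1.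
have SB u : 'd xK theta (B u) = D u := (GP _ (tD u)).2.
pose T := tangent (@usphere R n) theta; pose Y := vbasis T.
have TP u : u \in T <-> dot theta u = 0.
  by rewrite /T tangent_usphere//; exact: orthogonal_spaceP.
have VP u : u \in tspace K M (sg theta) <-> exists2 w, w \in T & u = 'd sg theta w.
  apply: (iff_trans (tangent_radial hM u st)).
  by split=> -[w wT uE]; exists w; [exact/TP | exact: uE | exact/TP | exact: uE].
transitivity (\sum_i coord Y i (B Y`_i)).
  have := @trace_conjugate R _ (tspace K M (sg theta)) T ('d sg theta) BL
    (fun v => ca_connection K M v (ca_grad K M f) (sg theta)).
  apply => [u|w /TP tw w0|w _|w /TP tw].
  - exact: VP.
  - by apply: (dsg_inj hM st tw (dot0r _)); rewrite w0 linear0.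
  - by apply/TP; exact: tB.
  - exact: (ca_connection_radial hK hM param_sg hf st tw (tB w) (SB w)).
set Mx := D2mx h theta.
pose c := \matrix_(i, k) coord Y k (B Y`_i) : 'M[R]_(\dim T).
have NE : D2mx (fun y => z y * h y) theta = (c + (F theta)%:M) *m Mx.
  apply/matrixP => i j; rewrite mxE (D2_mul_support_fun _ _ zF st) mulmxDl mul_scalar_mx.
  rewrite dotDl dotZl [RHS]mxE [X in _ = _ + X]mxE -/Mx [Mx i j]mxE (D2_support_fun _ _ st).
  congr (_ + _).
  have BT : B Y`_i \in T by apply/TP; exact: tB.
  rewrite -/(D Y`_i) -SB [X in 'd xK theta X](coord_vbasis BT) [RHS]mxE.
  rewrite (linear_sum ('d xK theta)) dotC (linear_sum (dot Y`_j)).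
  apply: eq_bigr => k _; rewrite [c i k]mxE [Mx k j]mxE (D2_support_fun _ _ st).
  by rewrite [X in dot _ X = _]linearZ dotZr dotC.
rewrite /HBM -/Mx NE.
have -> : \sum_i coord Y i (B Y`_i) = \tr c by apply: eq_bigr => i _; rewrite mxE.
have -> : \sum_i \sum_j invmx Mx i j * ((c + (F theta)%:M) *m Mx) i j =
    \tr ((c + (F theta)%:M) *m Mx *m (invmx Mx)^T).
  apply: eq_bigr => i _; rewrite mxE; apply: eq_bigr => j _.
  by rewrite [(invmx Mx)^T _ _]mxE mulrC.
rewrite trmx_inv D2mx_support_fun_sym// mulmxK ?D2mx_support_fun_unit//.
have dimT : (\dim T)%:R = n%:R - 1 :> R.
  by rewrite /T tangent_usphere//; exact: dim_orthogonal_space.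
by rewrite mxtraceD mxtrace_scalar zF// -dimT mulr_natl addrK.
Qed.

End LaplacianHBM.

(** * The four parametrizations *)

Section Charts.
Context {R : realType} {n : nat} (K : set 'rV[R]_n) (hK : smooth_curved_body K).
Local Notation E := 'rV[R]_n.
Implicit Types (p u v y theta : E).

Local Notation h := (support_fun K).
Local Notation xK := (support_point K).

Lemma dsupport_point_inj theta v : usphere theta -> dot theta v = 0 ->
  'd xK theta v = 0 -> v = 0.
Proof.
move=> st tv Sv; apply/eqP; apply: contraT => v0.
by have := dsupport_point_gt0 hK st tv v0; rewrite Sv dot0r ltxx.
Qed.

Lemma support_point_neq0 y : y != 0 -> xK y != 0.
Proof.
move=> y0; apply: contraTneq (support_fun_gt0 hK y0) => x0.
by rewrite (support_funE hK) x0 dot0r ltxx.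
Qed.

Lemma radial_chart_boundary : radial_chart (bdry K) xK.
Proof.
split.
- exact: Cinfty_support_point.
- by move=> t y; exact: support_pointZ.
- split=> [theta st|theta1 theta2 /set_mem s1 /set_mem s2|p bp].
  + by apply: (support_point_bdry hK); exact: usphere_neq0.
  + exact: support_point_inj.
  + by have [y sy yp] := support_point_surj hK bp; exists y.
- move=> theta v st vE; have t0 := usphere_neq0 st.
  have tv : dot theta v = 0.
    have := congr1 (dot theta) vE.
    rewrite dotDr dotZr (dot_dsupport_point hK)// addr0 -(support_funE hK) dot0r.
    by move/eqP; rewrite mulf_eq0 [h _ == 0]gt_eqF ?support_fun_gt0// orbF => /eqP.
  apply: (dsupport_point_inj st tv).
  by move: vE; rewrite tv scale0r add0r.
Qed.

Lemma Ck_support_fun k : Ck k [set y : E | y != 0] h.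
Proof.
have -> : h = (fun y => dot y (xK y)) by apply/funext => y; exact: support_funE.
apply: (Ck_dot (@open_neq0 R E)); first exact: Ck_id.
exact: Cinfty_support_point.
Qed.

Lemma support_fun_continuous : continuous h.
Proof.
have [M M0 MK] := dot_bounded_on_body hK.
have lip y z : h y - h z <= M * `|y - z|.
  have [Kx _] := support_pointP hK y; have [_ zm] := support_pointP hK z.
  rewrite (le_trans _ (MK _ _ Kx))// (le_trans _ (ler_norm _))//.
  by rewrite !(support_funE hK) dotBl lerD2l lerN2 zm.
suff cy y (e : R) : 0 < e -> \forall z \near y, `|h y - h z| <= e.
  by move=> y; exact: (cvgrPdist_le _ _).2 (cy y).
move=> e0.
have eM : 0 < e / M by rewrite divr_gt0.
have nb : \forall z \near y, `|y - z| < e / M.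
  by have := nbhsx_ballx y _ eM; rewrite -ball_normE.
apply: filterS nb => z /ltW zy; have zM : M * `|y - z| <= e by rewrite -ler_pdivlMl// mulrC.
rewrite ler_norml lerNl opprB; apply/andP; split; last exact: le_trans (lip _ _) zM.
by apply: le_trans (lip _ _) _; rewrite distrC.
Qed.

Lemma bdry_dual_body p : bdry (dual_body K) p <-> h p = 1.
Proof.
have cD : closed (dual_body K).
  have -> : dual_body K = h @^-1` [set x | x <= 1] by [].
  apply: closed_comp => [x _|]; [exact: support_fun_continuous | exact: closed_le].
split=> [[/cD hp ni]|hp].
  apply/eqP; rewrite eq_le hp leNgt; apply/negP => hp1; apply: ni.
  have np : \forall q \near p, h q < 1 := support_fun_continuous (lt_nbhsl hp1).
  by apply: filterS np => q /ltW.
split; first by apply: subset_closure; rewrite /dual_body /= hp.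
move=> /(near_line p)/near0_gt0[t /andP[t0 _]].
rewrite /dual_body /= -[X in X + _]scale1r -scalerDl.
by rewrite (support_funZ hK) ?addr_gt0// hp mulr1 gerDl leNgt t0.
Qed.

Lemma radial_chart_dual_boundary :
  radial_chart (bdry (dual_body K)) (fun y => (h y)^-1 *: y).
Proof.
have csg : Cinfty [set y : E | y != 0] (fun y => (h y)^-1 *: y).
  move=> k; have o0 := @open_neq0 R E.
  apply: (Ck_scaler o0 _ (Ck_id _ _)).
  by apply: (Ck_inv o0 _ (Ck_support_fun k)) => y y0; rewrite gt_eqF// (support_fun_gt0 hK).
have hom (t : R) y : 0 < t -> y != 0 -> (h (t *: y))^-1 *: (t *: y) = (h y)^-1 *: y.
  move=> t0 y0; rewrite (support_funZ hK)// scalerA invfM mulrAC.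
  by rewrite mulVf ?mul1r// gt_eqF.
have normE theta : usphere theta -> normalize ((h theta)^-1 *: theta) = theta.
  move=> st; have hi : 0 < (h theta)^-1.
    by rewrite invr_gt0 (support_fun_gt0 hK)// usphere_neq0.
  by rewrite /normalize enormZ ?ltW// st mulr1 scalerA mulVf ?scale1r// gt_eqF.
split.
- exact: csg.
- exact: hom.
- split=> [theta st|theta1 theta2 /set_mem s1 /set_mem s2 e|p /bdry_dual_body hp].
  + have h0 := support_fun_gt0 hK (usphere_neq0 st).
    by apply/bdry_dual_body; rewrite (support_funZ hK) ?invr_gt0// mulVf// gt_eqF.
  + by rewrite -(normE _ s1) e normE.
  + have p0 : p != 0.
      by apply: contra_eq_neq hp => ->; rewrite (support_fun0 hK) eq_sym oner_neq0.
    exists (normalize p); first exact: usphere_normalize.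
    by rewrite /normalize hom ?invr_gt0 ?enorm_gt0// hp invr1 scale1r.
- move=> theta v st; have t0 := usphere_neq0 st; have h0 := support_fun_gt0 hK t0.
  have hn : h theta != 0 by rewrite gt_eqF.
  have dsg := (csg 1%N).1 theta t0.
  have [dh dhE] := is_diff_support_fun hK t0.
  have dhd : is_derive theta v h (dot (xK theta) v) by rewrite -dhE; exact: is_derive_diff.
  have dhi : is_derive theta v (fun y => (h y)^-1) (- (h theta ^+ 2)^-1 * dot (xK theta) v).
    by have [? dE] := dhd; split; [exact: derivableV | rewrite deriveV// dE].
  rewrite (diff_val_derive dsg (is_derive_scaler dhi (is_derive_id theta v))) => vE.
  pose c := dot (xK theta) v / h theta - dot theta v.
  have vc : v = c *: theta.
    have : h theta *: (dot theta v *: ((h theta)^-1 *: theta) +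
      (- (h theta ^+ 2)^-1 * dot (xK theta) v *: theta + (h theta)^-1 *: v)) = 0.
      by rewrite vE scaler0.
    rewrite !scalerDr !scalerA mulfV// scale1r addrA -scalerDl.
    move/(canRL (addKr _)); rewrite addr0 -scaleNr => ->; congr (_ *: _).
    by rewrite /c; field.
  have tc : dot theta v = c by rewrite vc dotZr (usphereE theta).1// mulr1.
  have xc : dot (xK theta) v = c * h theta by rewrite vc dotZr (support_funE hK) dotC.
  have c0 : c = 0.
    have : c = c - c by rewrite {1}/c xc tc mulfK.
    by rewrite subrr.
  by rewrite vc c0 scale0r.
Qed.

Lemma minkowski_gauge_bdry p (s : R) : bdry K p -> 0 < s ->
  minkowski_gauge K (s *: p) = s.
Proof.
move=> bp s0; have [y sy yp] := support_point_surj hK bp.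
have y0 := usphere_neq0 sy; have [_ ym] := support_pointP hK y.
have h0 := support_fun_gt0 hK y0; rewrite (support_funE hK) yp in h0.
rewrite yp in ym; rewrite /minkowski_gauge; set A := [set t | _].
have As : A s by split=> //=; rewrite scalerA mulVf ?scale1r ?gt_eqF//; exact: body_bdry.
have lA : lbound A s.
  move=> t [t0]; rewrite scalerA => /ym; rewrite dotZr ger_pMl// mulrC.
  by rewrite ler_pdivrMr// mul1r.
apply/eqP; rewrite eq_le; apply/andP; split; first by apply: ge_inf => //; exists s.
by apply: lb_le_inf => //; exists s.
Qed.

(** The last point of the body on a ray is a boundary point. *)
Lemma ray_bdry (e : E) : usphere e -> exists2 s : R, 0 < s & bdry K (s *: e).
Proof.
move=> se; have e1 := (usphereE e).1 se; have [cK _ K0 _] := hK.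
pose g (q : E) := q - dot e q *: e.
have cg : continuous g.
  move=> q; apply: differentiable_continuous; apply: differentiableB => //.
  apply: differentiable_scaler => //.
  exact: linear_differentiable (@linear_rV_continuous _ _ _ _).
have cC : compact (K `&` g @^-1` [set 0]).
  apply: compact_closedI => //; apply: closed_comp => [q _|]; first exact: cg.
  exact/accessible_closed_set1/hausdorff_accessible/norm_hausdorff.
have rayC (s : R) : K (s *: e) -> (K `&` g @^-1` [set 0]) (s *: e).
  by move=> Ks; split=> //=; rewrite /g dotZr e1 mulr1 subrr.
have C0 : (K `&` g @^-1` [set 0]) !=set0.
  by exists (0 *: e); apply: rayC; rewrite scale0r; exact: nbhs_singleton K0.
have cd : {within K `&` g @^-1` [set 0], continuous (dot e)}.
  by apply: continuous_subspaceT; exact: linear_rV_continuous.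
have [q /set_mem[Kq gq] qmax] := EVT_max_rV C0 cC cd.
have qE : q = dot e q *: e by apply/eqP; rewrite -subr_eq0; apply/eqP.
have le_q (s : R) : K (s *: e) -> s <= dot e q.
  by move=> Ks; have := qmax _ (mem_set (rayC _ Ks)); rewrite dotZr e1 mulr1.
exists (dot e q).
  have [t /andP[t0 _]] := near0_gt0 (near_line e K0).
  by rewrite add0r => /le_q; exact: lt_le_trans.
rewrite -qE; split; first exact: subset_closure.
move=> /(near_line e)/near0_gt0[t /andP[t0 _]].
by rewrite {1}qE -scalerDl => /le_q; rewrite gerDl leNgt t0.
Qed.

Lemma radial_chart_primal_sphere :
  radial_chart (@usphere R n) (fun y => normalize (xK y)).
Proof.
have csg : Cinfty [set y : E | y != 0] (fun y => normalize (xK y)).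
  move=> k; apply: (Ck_normalized (@open_neq0 R E) _ (Cinfty_support_point hK k)).
  exact: support_point_neq0.
split.
- exact: csg.
- by move=> t y t0 y0; rewrite support_pointZ.
- split=> [theta st|theta1 theta2 /set_mem s1 /set_mem s2 e|p sp].
  + by apply: usphere_normalize; apply: support_point_neq0; exact: usphere_neq0.
  + have le_enorm t1 t2 : usphere t1 -> usphere t2 ->
        normalize (xK t1) = normalize (xK t2) -> enorm (xK t1) <= enorm (xK t2).
      move=> st1 st2 e12; have t20 := usphere_neq0 st2.
      have x10 := support_point_neq0 (usphere_neq0 st1).
      have x20 := support_point_neq0 t20.
      have h2 := support_fun_gt0 hK t20.
      have xE : xK t1 = (enorm (xK t1) / enorm (xK t2)) *: xK t2.
        rewrite -scalerA -[(enorm (xK t2))^-1 *: _]/(normalize _) -e12 scalerA.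
        by rewrite mulfV ?scale1r// gt_eqF// enorm_gt0.
      have := (support_pointP hK t2).2 _ (support_pointP hK t1).1.
      rewrite [X in dot _ X <= _]xE dotZr -(support_funE hK) ger_pMl//.
      by rewrite ler_pdivrMr ?enorm_gt0// mul1r.
    apply: (support_point_inj hK s1 s2).
    have nE : enorm (xK theta1) = enorm (xK theta2).
      by apply/eqP; rewrite eq_le !le_enorm.
    have x0 : enorm (xK theta2) != 0.
      by rewrite gt_eqF// enorm_gt0; apply: support_point_neq0; exact: usphere_neq0.
    have := congr1 (fun z => enorm (xK theta2) *: z) e.
    by rewrite /normalize nE !scalerA mulfV// !scale1r.
  + have [s s0 bs] := ray_bdry sp; have [y sy yp] := support_point_surj hK bs.
    exists y => //; rewrite yp /normalize enormZ ?ltW// sp mulr1 scalerA.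
    by rewrite mulVf ?scale1r// gt_eqF.
- move=> theta v st; have t0 := usphere_neq0 st.
  have x0 := support_point_neq0 t0; have h0 := support_fun_gt0 hK t0.
  have dsg := (csg 1%N).1 theta t0.
  have dn : differentiable (@normalize R n) (xK theta) := (Cinfty_normalize 1%N).1 _ x0.
  have dx := differentiable_support_point hK t0.
  have dnx := is_derive_chain dn (is_derive_diff v dx).
  rewrite (diff_val_derive dsg dnx) (diff_val_derive dn (derive_normalize _ x0)).
  set r := (enorm (xK theta))^-1; set b := dot (xK theta) _ / _.
  have r0 : r != 0 by rewrite invr_neq0// gt_eqF// enorm_gt0.
  move=> vE; have {}vE : (dot theta v - b) *: xK theta + 'd xK theta v = 0.
    have : r *: ((dot theta v - b) *: xK theta + 'd xK theta v) = 0.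
      rewrite -vE /normalize -/r scalerDr scalerBl !scalerBr !scalerA.
      by rewrite (mulrC r (dot theta v)) -addrA; congr (_ + _); exact: addrC.
    by move/eqP; rewrite scaler_eq0 (negbTE r0) => /eqP.
  have tvb : dot theta v - b = 0.
    have := congr1 (dot theta) vE.
    rewrite dotDr dotZr (dot_dsupport_point hK)// addr0 -(support_funE hK) dot0r.
    by move/eqP; rewrite mulf_eq0 [h _ == 0]gt_eqF// orbF => /eqP.
  have Sv : 'd xK theta v = 0 by move: vE; rewrite tvb scale0r add0r.
  have tv : dot theta v = 0.
    by move/eqP: tvb; rewrite /b Sv dot0r mul0r subr0 => /eqP.
  exact: (dsupport_point_inj st tv Sv).
Qed.

Lemma radial_chart_domain (M : domain) : exists sg : E -> E,
  radial_chart (carrier K M) sg /\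
  forall theta, usphere theta -> param K M (sg theta) = xK theta.
Proof.
case: M => /=.
- exists (@normalize R n); split; first exact: radial_chart_normalize.
  move=> theta st; rewrite normalize_usphere// egrad_support_fun//.
  exact: usphere_neq0.
- by exists xK; split; first exact: radial_chart_boundary.
- exists (fun y => normalize (xK y)); split; first exact: radial_chart_primal_sphere.
  move=> theta st; have t0 := usphere_neq0 st; have x0 := support_point_neq0 t0.
  have e0 : 0 < (enorm (xK theta))^-1 by rewrite invr_gt0 enorm_gt0.
  rewrite [X in minkowski_gauge K X]/normalize minkowski_gauge_bdry//.
    by rewrite /normalize invrK scalerA mulfV ?scale1r// gt_eqF// enorm_gt0.
  exact: support_point_bdry.
- exists (fun y => (h y)^-1 *: y); split; first exact: radial_chart_dual_boundary.
  move=> theta st; have t0 := usphere_neq0 st.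
  have h0 : 0 < (h theta)^-1 by rewrite invr_gt0 (support_fun_gt0 hK).
  rewrite egrad_support_fun ?support_pointZ//.
  by rewrite scaler_eq0 negb_or gt_eqF.
Qed.

Lemma transition_from_dual_sphere (M : domain) sg theta :
  radial_chart (carrier K M) sg ->
  (forall y, usphere y -> param K M (sg y) = xK y) -> usphere theta ->
  transition K DualSphere M theta = sg theta.
Proof.
move=> hM psg st; have t0 := usphere_neq0 st; have [_ _ [fsg _ surj] _] := hM.
rewrite /transition /= egrad_support_fun// -psg//.
apply: pinvKV; last by rewrite inE; exact: fsg.
move=> p q /set_mem/surj[y sy <-] /set_mem/surj[z sz <-].
by rewrite !psg// => /(support_point_inj hK sy sz) ->.
Qed.

Lemma transition_to_dual_sphere (M : domain) sg theta :
  (forall y, usphere y -> param K M (sg y) = xK y) -> usphere theta ->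
  transition K M DualSphere (sg theta) = theta.
Proof.
move=> psg st; rewrite /transition /= psg// -egrad_support_fun ?usphere_neq0//.
apply: pinvKV; last by rewrite inE.
move=> y z /set_mem sy /set_mem sz; rewrite !egrad_support_fun ?usphere_neq0//.
exact: support_point_inj.
Qed.

End Charts.

Theorem theorem4p8 (R : realType) (n : nat) (K : set 'rV[R]_n) :
  (2 <= n)%N -> smooth_curved_body K ->
  (forall f : 'rV[R]_n -> R,
     Ck_on 2 (carrier K DualSphere) f ->
     forall theta, carrier K DualSphere theta ->
       ca_laplacian K DualSphere f theta = HBM K f theta) /\
  (forall (M : domain) (f : 'rV[R]_n -> R),
     M <> DualSphere ->
     Ck_on 2 (carrier K M) f ->
     forall p, carrier K M p ->
       ca_laplacian K M f p = transport K M (HBM K) f p).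
Proof.
move=> _ hK; split=> [f hf theta st|M f _ hf p Mp].
  have psg y : usphere y -> param K DualSphere (normalize y) = support_point K y.
    by move=> sy; rewrite normalize_usphere//= egrad_support_fun// usphere_neq0.
  rewrite -[in LHS](normalize_usphere st).
  apply: (@ca_laplacian_radial R n K hK DualSphere _ radial_chart_normalize psg f hf) => //.
  by move=> y sy /=; rewrite normalize_usphere.
have [sg [hM psg]] := radial_chart_domain hK M.
have [_ _ [_ _ surj] _] := hM; have [theta st <-] := surj p Mp.
rewrite /transport /= (transition_to_dual_sphere hK psg)//.
apply: (ca_laplacian_radial hK hM psg hf) => // y sy /=.
by rewrite (transition_from_dual_sphere hK hM psg).
Qed.
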